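(* Let $(\mathcal{B}',\Delta,\varepsilon)$ be a $\mathbb{Z}_2$-graded bialgebra over $\mathbb{C}$ with algebra generators $a',b',c',d'$ of parities $p(a')=p(d')=0$, $p(b')=p(c')=1$. Let $\mathcal{O}=\mathcal{O}(\mathbb{C}^{0,1}_t)$ be the $\mathbb{Z}_2$-graded algebra over $\mathbb{C}$ generated by $x,y$ with the single relation $xy=tyx$ and parities $p(x)=0$, $p(y)=1$. Consider the assignments $$\psi_L:\ x\mapsto a'\otimes x+b'\otimes y,\qquad y\mapsto c'\otimes x+d'\otimes y,$$ $$\psi_R:\ x\mapsto x\otimes a'+y\otimes c',\qquad y\mapsto x\otimes b'+y\otimes d'.$$ Then $\psi_L$ and $\psi_R$ provide (extend to) respectively a left and a right quantum $\mathcal{B}'$-space structure on $\mathcal{O}$ if and only if the following relations hold in $\mathcal{B}'$: $$a'b'=tb'a',\quad a'c'=tc'a',\quad b'c'=-c'b',\quad b'd'=-td'b',\quad c'd'=-td'c',\quad a'd'-d'a'=(t^{-1}-t)b'c',$$ and $$\Delta(a')=a'\otimes a'+b'\otimes c',\quad \Delta(b')=a'\otimes b'+b'\otimes d',\quad \Delta(c')=c'\otimes a'+d'\otimes c',\quad \Delta(d')=c'\otimes b'+d'\otimes d',$$ $$\varepsilon(a')=\varepsilon(d')=1,\qquad \varepsilon(b')=\varepsilon(c')=0.$$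
   Context: Throughout, $q\in\mathbb{C}$, $q\neq 0$, $q$ is not a root of $1$, and $t=\sqrt{-1}\,\sqrt{q}$ (so $t^2=-q$). Algebras are associative and unital; $p$ denotes the parity function of a $\mathbb{Z}_2$-graded space. The tensor product of $\mathbb{Z}_2$-graded algebras has multiplication $(u\otimes v)(u'\otimes v')=(-1)^{p(v)p(u')}uu'\otimes vv'$ on homogeneous elements, and the comultiplication and counit of a $\mathbb{Z}_2$-graded bialgebra are even algebra homomorphisms with respect to this multiplication. For a $\mathbb{Z}_2$-graded bialgebra $(A,\Delta,\varepsilon)$, a left quantum $A$-space is a pair $(B,\psi)$ where $B$ is an associative $\mathbb{Z}_2$-graded algebra and $\psi:B\to A\otimes B$ is an even algebra homomorphism with $(\mathrm{id}\otimes\psi)\circ\psi=(\Delta\otimes\mathrm{id})\circ\psi$ and $(\varepsilon\otimes\mathrm{id})\circ\psi=\mathrm{id}$. Similarly, a right quantum $A$-space is a pair $(B,\psi)$ with $\psi:B\to B\otimes A$ an even algebra homomorphism such that $(\psi\otimes\mathrm{id})\circ\psi=(\mathrm{id}\otimes\Delta)\circ\psi$ and $(\mathrm{id}\otimes\varepsilon)\circ\psi=\mathrm{id}$. *)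

(* Defs.v *)
From HB Require Import structures.
From mathcomp Require Import all_boot all_order all_algebra.
From mathcomp Require Import boolp classical_sets.

Set Implicit Arguments.
Unset Strict Implicit.
Unset Printing Implicit Defensive.

Import GRing.Theory.

Local Open Scope ring_scope.
Local Open Scope quotient_scope.

(* Mathcomp has no tensor product of arbitrary vector spaces and no algebras
   given by noncommutative generators and relations.  Both are constructed
   below as quotients: formal expressions modulo the congruence generated by
   the defining identities. *)

Section TensorCongruence.
Variables (K : fieldType) (U V : lmodType K).

(* A list [:: (u1, v1); (u2, v2); ...] stands for u1 (x) v1 + u2 (x) v2 + ... *)
Inductive tensor_cong : seq (U * V) -> seq (U * V) -> Prop :=
| tc_refl s : tensor_cong s s
| tc_sym s1 s2 : tensor_cong s1 s2 -> tensor_cong s2 s1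
| tc_trans s1 s2 s3 :
    tensor_cong s1 s2 -> tensor_cong s2 s3 -> tensor_cong s1 s3
| tc_cat s1 s2 s1' s2' :
    tensor_cong s1 s1' -> tensor_cong s2 s2' ->
    tensor_cong (s1 ++ s2) (s1' ++ s2')
| tc_comm s1 s2 : tensor_cong (s1 ++ s2) (s2 ++ s1)
| tc_0l v : tensor_cong [:: (0, v)] [::]
| tc_addl u u' v : tensor_cong [:: (u + u', v)] [:: (u, v); (u', v)]
| tc_addr u v v' : tensor_cong [:: (u, v + v')] [:: (u, v); (u, v')]
| tc_scale k u v : tensor_cong [:: (k *: u, v)] [:: (u, k *: v)].

Definition tensor_congb (s1 s2 : seq (U * V)) : bool := `[< tensor_cong s1 s2 >].

Lemma tensor_congb_refl : reflexive tensor_congb.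
Proof. by move=> s; apply/asboolP; exact: tc_refl. Qed.

Lemma tensor_congb_sym : symmetric tensor_congb.
Proof. by move=> s1 s2; apply/asboolP/asboolP => /tc_sym. Qed.

Lemma tensor_congb_trans : transitive tensor_congb.
Proof.
move=> s2 s1 s3 /asboolP s12 /asboolP s23; apply/asboolP.
exact: tc_trans s12 s23.
Qed.

Canonical tensor_equiv :=
  EquivRel tensor_congb tensor_congb_refl tensor_congb_sym tensor_congb_trans.

Definition tensor := {eq_quot tensor_equiv}.


HB.instance Definition _ : EqQuotient _ tensor_equiv tensor := EqQuotient.on tensor.
HB.instance Definition _ := Choice.on tensor.

Definition tensor_of (s : seq (U * V)) : tensor := \pi_tensor s.

Lemma tensor_ofP (P : tensor -> Prop) : (forall s, P (tensor_of s)) -> forall x, P x.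
Proof. by move=> h x; rewrite -[x]reprK; exact: h. Qed.

Lemma tensor_eqP s1 s2 : tensor_cong s1 s2 <-> tensor_of s1 = tensor_of s2.
Proof. by split=> [s12|/eqmodP/asboolP//]; apply/eqmodP/asboolP. Qed.

Lemma tensor_cong_repr s : tensor_cong (repr (tensor_of s)) s.
Proof. by apply/tensor_eqP; rewrite /tensor_of reprK. Qed.

Definition tensor_add (x y : tensor) : tensor := tensor_of (repr x ++ repr y).
Definition tensor_scale (k : K) (x : tensor) : tensor :=
  tensor_of [seq (k *: p.1, p.2) | p <- repr x].

Lemma tensor_add_pi s1 s2 :
  tensor_add (tensor_of s1) (tensor_of s2) = tensor_of (s1 ++ s2).
Proof. by apply/tensor_eqP; apply: tc_cat; exact: tensor_cong_repr. Qed.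

Lemma tensor_cong_scale k s1 s2 : tensor_cong s1 s2 ->
  tensor_cong [seq (k *: p.1, p.2) | p <- s1] [seq (k *: p.1, p.2) | p <- s2].
Proof.
elim=> {s1 s2} /=.
- by move=> s; exact: tc_refl.
- by move=> s1 s2 _ /tc_sym.
- by move=> s1 s2 s3 _ h _; exact: tc_trans.
- by move=> s1 s2 s1' s2' _ h1 _ h2; rewrite !map_cat; exact: tc_cat.
- by move=> s1 s2; rewrite !map_cat; exact: tc_comm.
- by move=> v; rewrite scaler0; exact: tc_0l.
- by move=> u u' v; rewrite scalerDr; exact: tc_addl.
- by move=> u v v'; exact: tc_addr.
- by move=> l u v; rewrite scalerA mulrC -scalerA; exact: tc_scale.
Qed.

Lemma tensor_scale_pi k s :
  tensor_scale k (tensor_of s) = tensor_of [seq (k *: p.1, p.2) | p <- s].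
Proof. by apply/tensor_eqP/tensor_cong_scale/tensor_cong_repr. Qed.

Lemma tensor_addA : associative tensor_add.
Proof.
move=> x y z; elim/tensor_ofP: x => s1; elim/tensor_ofP: y => s2; elim/tensor_ofP: z => s3.
by rewrite !tensor_add_pi catA.
Qed.

Lemma tensor_addC : commutative tensor_add.
Proof.
move=> x y; elim/tensor_ofP: x => s1; elim/tensor_ofP: y => s2; rewrite !tensor_add_pi.
by apply/tensor_eqP; exact: tc_comm.
Qed.

Lemma tensor_add0 : left_id (tensor_of [::]) tensor_add.
Proof. by move=> x; elim/tensor_ofP: x => s; rewrite tensor_add_pi. Qed.

Lemma tensor_scaleDl x k l :
  tensor_scale (k + l) x = tensor_add (tensor_scale k x) (tensor_scale l x).
Proof.
elim/tensor_ofP: x => s; rewrite !tensor_scale_pi tensor_add_pi; apply/tensor_eqP.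
elim: s => [|[u v] s IHs] /=; first exact: tc_refl.
rewrite scalerDl; apply: (@tc_trans _ ([:: (k *: u, v); (l *: u, v)] ++
  ([seq (k *: p.1, p.2) | p <- s] ++ [seq (l *: p.1, p.2) | p <- s]))).
  by rewrite -[_ :: _]cat1s; apply: tc_cat => //; exact: tc_addl.
apply: (@tc_cat [:: _] _ [:: _]); first exact: tc_refl.
rewrite -cat_rcons -cat_cons -cats1; apply: tc_cat; last exact: tc_refl.
exact: (tc_comm [:: _]).
Qed.

Lemma tensor_scale0 x : tensor_scale 0 x = tensor_of [::].
Proof.
elim/tensor_ofP: x => s; rewrite tensor_scale_pi; apply/tensor_eqP.
elim: s => [|[u v] s IHs] /=; first exact: tc_refl.
rewrite scale0r -[_ :: _]cat1s -[[::]]cat0s; apply: tc_cat => //; exact: tc_0l.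
Qed.

Lemma tensor_scale1 : left_id 1 tensor_scale.
Proof.
move=> x; elim/tensor_ofP: x => s; rewrite tensor_scale_pi; congr tensor_of.
by rewrite -[RHS]map_id; apply: eq_map => -[u v]; rewrite scale1r.
Qed.

Lemma tensor_addN :
  left_inverse (tensor_of [::]) (tensor_scale (-1)) tensor_add.
Proof.
by move=> x; rewrite -{2}[x]tensor_scale1 -tensor_scaleDl addNr tensor_scale0.
Qed.

HB.instance Definition _ :=
  GRing.isZmodule.Build tensor tensor_addA tensor_addC tensor_add0 tensor_addN.

Lemma tensor_scaleA k l x :
  tensor_scale k (tensor_scale l x) = tensor_scale (k * l) x.
Proof.
elim/tensor_ofP: x => s; rewrite !tensor_scale_pi -map_comp; congr tensor_of.
by apply: eq_map => -[u v] /=; rewrite scalerA.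
Qed.

Lemma tensor_scaleDr : right_distributive tensor_scale +%R.
Proof.
move=> k x y; elim/tensor_ofP: x => s1; elim/tensor_ofP: y => s2.
by rewrite [_ + _]tensor_add_pi !tensor_scale_pi [RHS]tensor_add_pi map_cat.
Qed.

HB.instance Definition _ := GRing.Zmodule_isLmodule.Build K tensor
  tensor_scaleA tensor_scale1 tensor_scaleDr tensor_scaleDl.

Definition tens (u : U) (v : V) : tensor := tensor_of [:: (u, v)].

Lemma tensDl v u u' : tens (u + u') v = tens u v + tens u' v.
Proof. by rewrite [RHS]tensor_add_pi; apply/tensor_eqP; exact: tc_addl. Qed.

Lemma tensDr u v v' : tens u (v + v') = tens u v + tens u v'.
Proof. by rewrite [RHS]tensor_add_pi; apply/tensor_eqP; exact: tc_addr. Qed.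

Lemma tensZl k u v : tens (k *: u) v = k *: tens u v.
Proof. by rewrite [RHS]tensor_scale_pi. Qed.

Lemma tensZr k u v : tens u (k *: v) = k *: tens u v.
Proof. by rewrite -tensZl; apply/esym/tensor_eqP; exact: tc_scale. Qed.

Lemma tens_bilinear : bilinear_for *:%R *:%R tens.
Proof.
split=> [v k u u'|u k v v'] /=; first by rewrite tensDl tensZl.
by rewrite tensDr tensZr.
Qed.

Lemma tensor_pi_cons u v s : tensor_of ((u, v) :: s) = tens u v + tensor_of s.
Proof. by rewrite [RHS]tensor_add_pi. Qed.

Lemma tensor_ind (P : tensor -> Prop) :
  P 0 -> (forall x y, P x -> P y -> P (x + y)) -> (forall u v, P (tens u v)) ->
  forall x, P x.
Proof.
move=> P0 PD Pt x; elim/tensor_ofP: x; elim=> [|[u v] s IHs]; first exact: P0.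
by rewrite tensor_pi_cons; apply: PD.
Qed.

End TensorCongruence.

Section TensorLift.
Variables (K : fieldType) (U V W : lmodType K).

(* For bilinear f, this is the linear map induced by f (tensor_lift_tens);
   for other f the value is meaningless. *)
Definition tensor_lift (f : U -> V -> W) (x : tensor U V) : W :=
  \sum_(p <- repr x) f p.1 p.2.

Lemma tensor_lift_fun_linear k (f g h : U -> V -> W) x :
  (forall u v, f u v = k *: g u v + h u v) ->
  tensor_lift f x = k *: tensor_lift g x + tensor_lift h x.
Proof.
move=> fE; rewrite /tensor_lift scaler_sumr -big_split.
by apply: eq_bigr => p _; exact: fE.
Qed.

Variables (f : U -> V -> W) (f_bil : bilinear_for *:%R *:%R f).

Let fDl u u' v : f (u + u') v = f u v + f u' v.
Proof. by have := f_bil.1 v 1 u u'; rewrite /= !scale1r. Qed.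
Let fDr u v v' : f u (v + v') = f u v + f u v'.
Proof. by have := f_bil.2 u 1 v v'; rewrite /= !scale1r. Qed.
Let f0l v : f 0 v = 0.
Proof. by apply: (addrI (f 0 v)); rewrite -fDl !addr0. Qed.
Let f0r u : f u 0 = 0.
Proof. by apply: (addrI (f u 0)); rewrite -fDr !addr0. Qed.
Let fZl k u v : f (k *: u) v = k *: f u v.
Proof. by have := f_bil.1 v k u 0; rewrite /= !addr0 f0l addr0. Qed.
Let fZr k u v : f u (k *: v) = k *: f u v.
Proof. by have := f_bil.2 u k v 0; rewrite /= !addr0 f0r addr0. Qed.

Let tensor_lift_cong s1 s2 : tensor_cong s1 s2 ->
  \sum_(p <- s1) f p.1 p.2 = \sum_(p <- s2) f p.1 p.2.
Proof.
elim=> {s1 s2} //=.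
- by move=> s1 s2 s3 _ -> _ ->.
- by move=> s1 s2 s1' s2' _ h1 _ h2; rewrite !big_cat /= h1 h2.
- by move=> s1 s2; rewrite !big_cat /= addrC.
- by move=> v; rewrite big_seq1 big_nil f0l.
- by move=> u u' v; rewrite !big_cons !big_nil /= fDl !addr0.
- by move=> u v v'; rewrite !big_cons !big_nil /= fDr !addr0.
- by move=> k u v; rewrite !big_seq1 /= fZl fZr.
Qed.

Lemma tensor_lift_pi s :
  tensor_lift f (tensor_of s) = \sum_(p <- s) f p.1 p.2.
Proof.
apply: tensor_lift_cong; exact: tensor_cong_repr.
Qed.

Lemma tensor_lift_tens u v : tensor_lift f (tens u v) = f u v.
Proof. by rewrite tensor_lift_pi big_seq1. Qed.

Lemma tensor_lift_linear : linear (tensor_lift f).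
Proof.
move=> k x y; elim/tensor_ofP: x => s1; elim/tensor_ofP: y => s2.
rewrite [_ *: _]tensor_scale_pi [_ + _]tensor_add_pi !tensor_lift_pi.
rewrite big_cat big_map /= scaler_sumr; congr (_ + _).
by apply: eq_bigr => p _; exact: fZl.
Qed.

End TensorLift.

Section TensorMaps.
Variables (K : fieldType).

Definition tensor_map (U V U' V' : lmodType K)
    (f : {linear U -> U'}) (g : {linear V -> V'}) : tensor U V -> tensor U' V' :=
  tensor_lift (fun u v => tens (f u) (g v)).

Definition tensor_assoc (U V W : lmodType K) :
    tensor (tensor U V) W -> tensor U (tensor V W) :=
  tensor_lift (fun x w => tensor_lift (fun u v => tens u (tens v w)) x).

Definition tensor_unitl (V : lmodType K) : tensor K^o V -> V :=
  tensor_lift (fun (k : K^o) (v : V) => (k : K) *: v).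

Definition tensor_unitr (V : lmodType K) : tensor V K^o -> V :=
  tensor_lift (fun (v : V) (k : K^o) => (k : K) *: v).

End TensorMaps.

Lemma tensor_map_bilinear (K : fieldType) (U V U' V' : lmodType K)
    (f : {linear U -> U'}) (g : {linear V -> V'}) :
  bilinear_for *:%R *:%R (fun u v => tens (f u) (g v)).
Proof.
split=> [v k u u'|u k v v'] /=; rewrite linearP.
  by rewrite tensDl tensZl.
by rewrite tensDr tensZr.
Qed.

Lemma tensor_map_tens (K : fieldType) (U V U' V' : lmodType K)
    (f : {linear U -> U'}) (g : {linear V -> V'}) u v :
  tensor_map f g (tens u v) = tens (f u) (g v).
Proof. exact/tensor_lift_tens/tensor_map_bilinear. Qed.

Lemma tensor_assoc_bilinear (K : fieldType) (U V W : lmodType K) (w : W) :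
  bilinear_for *:%R *:%R (fun (u : U) (v : V) => tens u (tens v w)).
Proof.
split=> [v k u u'|u k v v'] /=; rewrite ?(tensDl, tensZl, tensDr, tensZr) //.
Qed.

Lemma tensor_assoc_tens (K : fieldType) (U V W : lmodType K) (u : U) (v : V) (w : W) :
  tensor_assoc (tens (tens u v) w) = tens u (tens v w).
Proof.
rewrite /tensor_assoc tensor_lift_tens; last first.
  split=> [{}w|x k {}w w'] /=.
    exact/tensor_lift_linear/tensor_assoc_bilinear.
  by apply: tensor_lift_fun_linear => {}u {}v; rewrite !(tensDr, tensZr).
by rewrite tensor_lift_tens //; exact: tensor_assoc_bilinear.
Qed.

Lemma tensor_unitl_tens (K : fieldType) (V : lmodType K) (k : K) (v : V) :
  tensor_unitl (tens (k : K^o) v) = k *: v.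
Proof.
rewrite /tensor_unitl tensor_lift_tens //.
split=> [{}v l a b|a l {}v v'] /=.
  by rewrite scalerDl scalerA.
by rewrite scalerDr !scalerA mulrC.
Qed.

Lemma tensor_unitr_tens (K : fieldType) (V : lmodType K) (k : K) (v : V) :
  tensor_unitr (tens v (k : K^o)) = k *: v.
Proof.
rewrite /tensor_unitr tensor_lift_tens //.
split=> [a l {}v v'|{}v l a b] /=.
  by rewrite scalerDr !scalerA mulrC.
by rewrite scalerDl scalerA.
Qed.

(* Z_2-graded algebras: homog i is the component of parity i, with false for
   even and true for odd, so that parities add by (+). *)
HB.mixin Record isSuperAlgebra (K : fieldType) A of GRing.Algebra K A := {
  homog : bool -> set A;
  homog0 : forall i, homog i 0;
  homogP : forall i k (u v : A), homog i u -> homog i v -> homog i (k *: u + v);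
  homogM : forall i j (u v : A),
    homog i u -> homog j v -> homog (i (+) j) (u * v);
  homog_decomp : forall u : A,
    exists u0 u1, [/\ homog false u0, homog true u1 & u = u0 + u1];
  homog_direct : forall u : A, homog false u -> homog true u -> u = 0
}.

#[short(type="superAlgType")]
HB.structure Definition SuperAlgebra (K : fieldType) :=
  {A of GRing.Algebra K A & isSuperAlgebra K A}.

Arguments homog {K s} i : rename.
Arguments homog0 {K s} i : rename.
Arguments homogM {K s i j u v} : rename.
Arguments homogP {K s i} k {u v} : rename.
Arguments homog_direct {K s u} : rename.

Section SuperAlgebraTheory.
Variables (K : fieldType) (A : superAlgType K).
Implicit Types u v : A.

Lemma homogD i u v : homog i u -> homog i v -> homog i (u + v).
Proof. by move=> hu hv; rewrite -[u]scale1r; exact: homogP. Qed.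

Lemma homogZ i k u : homog i u -> homog i (k *: u).
Proof. by move=> hu; rewrite -[_ *: _]addr0; apply: homogP => //; exact: homog0. Qed.

Lemma homogN i u : homog i u -> homog i (- u).
Proof. by rewrite -scaleN1r; exact: homogZ. Qed.

Lemma homog_part u : {p : bool -> A |
  (forall i, homog i (p i)) /\ u = p false + p true}.
Proof.
apply: cid; have [u0 [u1 [h0 h1 ->]]] := homog_decomp u.
by exists (fun i => if i then u1 else u0); split=> // -[].
Qed.

Definition hpart (i : bool) u : A := sval (homog_part u) i.

Lemma hpartP i u : homog i (hpart i u).
Proof. by rewrite /hpart; case: homog_part => p [hp _] /=. Qed.

Lemma hpartE u : u = hpart false u + hpart true u.
Proof. by rewrite /hpart; case: homog_part => p []. Qed.

Lemma hpart_uniq (p : bool -> A) u :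
  (forall i, homog i (p i)) -> u = p false + p true -> forall i, hpart i u = p i.
Proof.
move=> hp eu.
have e0 : hpart false u - p false = p true - hpart true u.
  apply/eqP; rewrite subr_eq addrAC -subr_eq opprK -hpartE addrC -eu //.
have d0 : hpart false u - p false = 0.
  apply: homog_direct; last rewrite e0.
    by apply: homogD; [exact: hpartP|exact/homogN/hp].
  by apply: homogD; [exact: hp|exact/homogN/hpartP].
case; first by apply/esym/eqP; rewrite -subr_eq0 -e0 d0.
by apply/eqP; rewrite -subr_eq0 d0.
Qed.

Lemma hpart_homog i j u : homog i u -> hpart j u = if i == j then u else 0.
Proof.
move=> hu; apply: (@hpart_uniq (fun j => if i == j then u else 0)).
  by move=> k; case: eqP => [<-//|_]; exact: homog0.
by case: (i); rewrite /= ?add0r ?addr0.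
Qed.

Lemma hpart_linear i : linear (hpart i).
Proof.
move=> k u v; apply: (@hpart_uniq (fun i => k *: hpart i u + hpart i v)).
  by move=> j; apply: homogP; exact: hpartP.
by rewrite {1}[u]hpartE {1}[v]hpartE scalerDr addrACA.
Qed.

HB.instance Definition _ i :=
  GRing.isLinear.Build K A A *:%R (hpart i) (hpart_linear i).

Lemma homog1 : homog false (1 : A).
Proof.
have e1_0 i u : homog i u -> u * hpart true 1 = 0.
  move=> hu; apply: homog_direct; case: i hu => hu.
  - exact: (homogM hu (hpartP true 1)).
  - have -> : u * hpart true 1 = u - u * hpart false 1.
      by rewrite -{2}[u]mulr1 {2}[1 : A]hpartE mulrDr addrC addKr.
    by apply: homogD => //; apply: homogN; exact: (homogM hu (hpartP false 1)).
  - have -> : u * hpart true 1 = u - u * hpart false 1.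
      by rewrite -{2}[u]mulr1 {2}[1 : A]hpartE mulrDr addrC addKr.
    by apply: homogD => //; apply: homogN; exact: (homogM hu (hpartP false 1)).
  - exact: (homogM hu (hpartP true 1)).
rewrite [X in homog _ X]hpartE -[hpart true 1]mul1r {2}[1 : A]hpartE mulrDl.
rewrite (e1_0 _ _ (hpartP false 1)) (e1_0 _ _ (hpartP true 1)) !addr0.
exact: hpartP.
Qed.

End SuperAlgebraTheory.

(* Used only to show that 1 (x) 1 is nonzero, since algType excludes the zero
   ring. *)
Section Functional.
Variables (K : fieldType) (V : lmodType K) (v : V).
Hypothesis v_neq0 : v != 0.

Lemma exists_functional : exists2 f : V -> K^o, linear f & f v = 1.
Proof.
pose P (W : set V) := (forall k x y, W x -> W y -> W (k *: x + y)) /\ ~ W v.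
have [|W [[WP Wv] Wmax]] := @Zorn_bigcup V P.
  move=> F FP Ftot; split=> [k x y [X FX Xx] [Y FY Yy]|[X /FP[_ Xv] /Xv//]].
  have [XY|YX] := Ftot _ _ FX FY.
    by exists Y => //; apply: (FP _ FY).1 => //; exact: XY.
  by exists X => //; apply: (FP _ FX).1 => //; exact: YX.
have W0 : W 0.
  apply: contrapT => W0; apply: (Wmax [set 0]%classic); last first.
    split=> [k _ _ -> ->|/= v0]; first by rewrite /= scaler0 addr0.
    by move: v_neq0; rewrite v0 eqxx.
  rewrite properEneq; split=> [|x Wx].
    by apply/eqP => eW; apply: W0; rewrite eW.
  by case: W0; rewrite -[0](addNr x) -scaleN1r; exact: WP.
have WZ k x : W x -> W (k *: x).
  by move=> Wx; rewrite -[_ *: _]addr0; exact: WP.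
have WD x y : W x -> W y -> W (x + y).
  by move=> Wx Wy; rewrite -[x]scale1r; exact: WP.
have Wex x : {k : K | W (x - k *: v)}.
  apply: cid; have [Wx|Wx] := pselect (W x).
    by exists 0; rewrite scale0r subr0.
  pose W' := [set z | exists k y, W y /\ z = k *: x + y]%classic.
  have [k [y [Wy ev]]] : W' v.
    apply: contrapT => W'v; apply: (Wmax W'); last first.
      split=> // k _ _ [l [y [Wy ->]]] [m [z [Wz ->]]].
      exists (k * l + m), (k *: y + z); split; first exact: WP.
      by rewrite scalerDr scalerA scalerDl addrACA.
    rewrite properEneq; split=> [|y Wy].
      apply/eqP => eW; apply: Wx; rewrite eW.
      by exists 1, 0; split=> //; rewrite scale1r addr0.
    by exists 0, y; rewrite scale0r add0r.
  have k0 : k != 0.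
    by apply: contra_notN Wv => /eqP k0; rewrite ev k0 scale0r add0r.
  exists k^-1; rewrite ev scalerDr scalerA mulVf // scale1r opprD addrA subrr.
  by rewrite add0r -scaleN1r; do 2 apply: (WZ).
have Wuniq x k l : W (x - k *: v) -> W (x - l *: v) -> k = l.
  move=> Wk Wl; apply: contrapT => /eqP kl; apply: Wv.
  have -> : v = (l - k)^-1 *: ((x - k *: v) + (-1) *: (x - l *: v)).
    rewrite scaleN1r opprB [X in _ *: X]addrC addrA subrK -scalerBl scalerA mulVf ?scale1r //.
    by rewrite subr_eq0 eq_sym.
  by apply: (WZ); apply: WD => //; exact: WZ.
pose f x : K^o := sval (Wex x).
have fP x : W (x - f x *: v) by rewrite /f; case: (Wex x).
exists f; last by apply: (Wuniq v) => //; rewrite scale1r subrr.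
move=> k x y; apply: (Wuniq (k *: x + y)) => //.
rewrite scalerDl opprD addrACA -scalerA -scalerBr.
exact: WP.
Qed.

End Functional.

(* The type tensor A B with the algebra structure twisted by the sign rule, as
   opposed to the bare vector space. *)
Definition stensor (K : fieldType) (A B : superAlgType K) : Type := tensor A B.

Notation "A ⊗ B" := (stensor A B) (at level 40, left associativity) : type_scope.
Notation "u ⊗ v" := (tens u v) (at level 40, left associativity) : ring_scope.

Section SuperTensor.
Variables (K : fieldType) (A B : superAlgType K).

HB.instance Definition _ := GRing.Lmodule.on (stensor A B).

Local Notation T := (stensor A B).

(* The sign rule extended to arbitrary u' and v by splitting them into their
   homogeneous components; see stens_mul. *)
Definition smul (u : A) (v : B) (u' : A) (v' : B) : T :=
  \sum_(i : bool) \sum_(j : bool)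
    (-1) ^+ (i && j) *: tens (u * hpart j u') (hpart i v * v').

Lemma smul_bilinearr u v : bilinear_for *:%R *:%R (smul u v).
Proof.
split=> [v' k x y|u' k x y] /=; rewrite /smul scaler_sumr -big_split;
  apply: eq_bigr => i _; rewrite scaler_sumr -big_split; apply: eq_bigr => j _ /=.
  by rewrite linearP mulrDr tensDl -scalerAr tensZl scalerDr !scalerA mulrC.
by rewrite mulrDr tensDr -scalerAr tensZr scalerDr !scalerA mulrC.
Qed.

Lemma smul_bilinearl u' v' :
  bilinear_for *:%R *:%R (fun u v => smul u v u' v').
Proof.
split=> [v k x y|u k x y] /=; rewrite /smul scaler_sumr -big_split;
  apply: eq_bigr => i _; rewrite scaler_sumr -big_split; apply: eq_bigr => j _ /=.
  by rewrite mulrDl tensDl -scalerAl tensZl scalerDr !scalerA mulrC.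
by rewrite linearP mulrDl tensDr -scalerAl tensZr scalerDr !scalerA mulrC.
Qed.

Definition stensor_mul (x y : T) : T :=
  tensor_lift (fun u v => tensor_lift (smul u v) y) x.

Let mul_bilinear y :
  bilinear_for *:%R *:%R (fun u v => tensor_lift (smul u v) y).
Proof.
split=> [v k u u'|u k v v'] /=; apply: tensor_lift_fun_linear => a b.
  exact: (smul_bilinearl a b).1.
exact: (smul_bilinearl a b).2.
Qed.

Lemma stensor_mul_linearl y : linear (stensor_mul^~ y).
Proof. exact: tensor_lift_linear. Qed.

Lemma stensor_mul_linearr x : linear (stensor_mul x).
Proof.
move=> k y y'; apply: tensor_lift_fun_linear => u v.
exact: (tensor_lift_linear (smul_bilinearr u v)).
Qed.

Lemma stensor_mul_tens u v u' v' :
  stensor_mul (tens u v) (tens u' v') = smul u v u' v'.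
Proof.
by rewrite /stensor_mul !tensor_lift_tens //; exact: smul_bilinearr.
Qed.

Lemma smul_homog i j u v u' v' : homog i v -> homog j u' ->
  smul u v u' v' = (-1) ^+ (i && j) *: (tens (u * u') (v * v') : T).
Proof.
move=> hv hu'; rewrite /smul (bigD1 i) //= (bigD1 j) //= [X in _ + X]big1.
  rewrite addr0 big1 => [|k kj].
    by rewrite addr0 !(hpart_homog _ hu', hpart_homog _ hv) !eqxx.
  by rewrite (hpart_homog _ hu') eq_sym (negPf kj) mulr0 -(scale0r 0) tensZl !scale0r scaler0.
move=> k ki; rewrite big1 // => l _.
by rewrite (hpart_homog _ hv) eq_sym (negPf ki) mul0r -(scale0r 0) tensZr !scale0r scaler0.
Qed.

Lemma stensor_ind (P : T -> Prop) :
  P 0 -> (forall x y, P x -> P y -> P (x + y)) ->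
  (forall i j u v, homog i u -> homog j v -> P (tens u v)) -> forall x, P x.
Proof.
move=> P0 PD Pt; apply: tensor_ind => // u v.
have Pp i j : P (tens (hpart i u) (hpart j v)).
  exact: Pt (hpartP i u) (hpartP j v).
by rewrite [u]hpartE [v]hpartE !(tensDl, tensDr); do 2 apply: (PD).
Qed.

Lemma stensor_mul0l y : stensor_mul 0 y = 0.
Proof. by rewrite -[0 in LHS](addNr 0) -scaleN1r (stensor_mul_linearl y) scaleN1r addNr. Qed.

Lemma stensor_mul0r x : stensor_mul x 0 = 0.
Proof. by rewrite -[0 in LHS](addNr 0) -scaleN1r (stensor_mul_linearr x) scaleN1r addNr. Qed.

Lemma stensor_mulDl : left_distributive stensor_mul +%R.
Proof.
by move=> x y z; have := stensor_mul_linearl z 1 x y; rewrite !scale1r.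
Qed.

Lemma stensor_mulDr : right_distributive stensor_mul +%R.
Proof.
by move=> x y z; have := stensor_mul_linearr x 1 y z; rewrite !scale1r.
Qed.

Lemma stensor_mulZl k x y : k *: stensor_mul x y = stensor_mul (k *: x) y.
Proof.
by have := stensor_mul_linearl y k x 0; rewrite /= !addr0 stensor_mul0l addr0.
Qed.

Lemma stensor_mulZr k x y : k *: stensor_mul x y = stensor_mul x (k *: y).
Proof.
by have := stensor_mul_linearr x k y 0; rewrite !addr0 stensor_mul0r addr0.
Qed.

Lemma stensor_mul_homog i j u v u' v' : homog i v -> homog j u' ->
  stensor_mul (tens u v) (tens u' v') =
  (-1) ^+ (i && j) *: (tens (u * u') (v * v') : T).
Proof. by move=> hv hu'; rewrite stensor_mul_tens; exact: smul_homog. Qed.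

Lemma stensor_mulA : associative stensor_mul.
Proof.
elim/stensor_ind => [|x x' IHx IHx'|i j u v hu hv] y z.
- by rewrite !stensor_mul0l.
- by rewrite !stensor_mulDl IHx IHx'.
elim/stensor_ind: y => [|y y' IHy IHy'|i' j' u' v' hu' hv'].
- by rewrite !(stensor_mul0l, stensor_mul0r).
- by rewrite stensor_mulDl !stensor_mulDr stensor_mulDl IHy IHy'.
elim/stensor_ind: z => [|z z' IHz IHz'|i2 j2 u2 v2 hu2 hv2].
- by rewrite !stensor_mul0r.
- by rewrite !stensor_mulDr IHz IHz'.
rewrite (stensor_mul_homog _ _ hv' hu2) (stensor_mul_homog _ _ hv hu').
rewrite -stensor_mulZr -stensor_mulZl.
rewrite (stensor_mul_homog _ _ hv (homogM hu' hu2)).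
rewrite (stensor_mul_homog _ _ (homogM hv hv') hu2) !scalerA !mulrA -!signr_addb.
by congr (_ ^+ nat_of_bool _ *: _); case: j {hv} j' {hv'} i' {hu'} i2 {hu2} => [] [] [] [].
Qed.

Lemma stensor_mul1l : left_id (tens 1 1 : T) stensor_mul.
Proof.
elim/stensor_ind => [|x x' IHx IHx'|i j u v hu hv].
- by rewrite stensor_mul0r.
- by rewrite stensor_mulDr IHx IHx'.
by rewrite (stensor_mul_homog _ _ (homog1 B) hu) !mul1r scale1r.
Qed.

Lemma stensor_mul1r : right_id (tens 1 1 : T) stensor_mul.
Proof.
elim/stensor_ind => [|x x' IHx IHx'|i j u v hu hv].
- by rewrite stensor_mul0l.
- by rewrite stensor_mulDl IHx IHx'.
by rewrite (stensor_mul_homog _ _ hv (homog1 A)) !mulr1 andbF scale1r.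
Qed.

Lemma stensor_1_neq0 : (tens 1 1 : T) != 0.
Proof.
have [f f_lin f1] := exists_functional (oner_neq0 A).
pose g (u : A) (v : B) : B := (f u : K) *: v.
have g_bil : bilinear_for *:%R *:%R g.
  split=> [v k u u'|u k v v'] /=; rewrite /g.
    by rewrite f_lin scalerDl scalerA.
  by rewrite scalerDr !scalerA mulrC.
have g0 : tensor_lift g 0 = 0.
  have := tensor_lift_linear g_bil (-1) 0 0.
  by rewrite scaler0 addr0 scaleN1r addNr.
apply/eqP => /(congr1 (tensor_lift g)); rewrite tensor_lift_tens // g0 /g f1.
by move/eqP; rewrite scale1r oner_eq0.
Qed.

HB.instance Definition _ := GRing.Zmodule_isNzRing.Build T
  stensor_mulA stensor_mul1l stensor_mul1r stensor_mulDl stensor_mulDr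
  stensor_1_neq0.

HB.instance Definition _ :=
  GRing.Lmodule_isLalgebra.Build K T stensor_mulZl.

HB.instance Definition _ :=
  GRing.Lalgebra_isAlgebra.Build K T stensor_mulZr.

Lemma stens_mul i j (u : A) (v : B) (u' : A) (v' : B) :
  homog i v -> homog j u' ->
  (u ⊗ v : T) * (u' ⊗ v') = (-1) ^+ (i && j) *: ((u * u') ⊗ (v * v') : T).
Proof. exact: stensor_mul_homog. Qed.

Lemma stens_one : (1 : T) = 1 ⊗ 1.
Proof. by []. Qed.

Inductive stensor_homog : bool -> set T :=
| sh_0 k : stensor_homog k 0
| sh_add k x y :
    stensor_homog k x -> stensor_homog k y -> stensor_homog k (x + y)
| sh_tens i j u v :
    homog i u -> homog j v -> stensor_homog (i (+) j) (u ⊗ v).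

Lemma stensor_homogP i k (x y : T) :
  stensor_homog i x -> stensor_homog i y -> stensor_homog i (k *: x + y).
Proof.
move=> hx hy; apply: sh_add => //; elim: hx => {i x hy}.
- by move=> i; rewrite scaler0; exact: sh_0.
- by move=> i x x' _ hx _ hx'; rewrite scalerDr; exact: sh_add.
- move=> i j u v hu hv; rewrite -tensZl; apply: sh_tens => //.
  exact: homogZ.
Qed.

Lemma stensor_homogM i j (x y : T) :
  stensor_homog i x -> stensor_homog j y -> stensor_homog (i (+) j) (x * y).
Proof.
move=> hx; elim: hx y => {i x}.
- by move=> i y _; rewrite mul0r; exact: sh_0.
- by move=> i x x' _ IHx _ IHx' y hy; rewrite mulrDl; apply: sh_add; auto.
move=> i1 i2 u v hu hv y; elim=> {j y}.
- by move=> j; rewrite mulr0; exact: sh_0.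
- by move=> j y y' _ IHy _ IHy'; rewrite mulrDr; exact: sh_add.
move=> j1 j2 u' v' hu' hv'; rewrite (stens_mul _ _ hv hu') addbACA.
rewrite -[_ *: _]addr0; apply: stensor_homogP; last exact: sh_0.
by apply: sh_tens; exact: homogM.
Qed.

Lemma stensor_homog_decomp (x : T) : exists x0 x1,
  [/\ stensor_homog false x0, stensor_homog true x1 & x = x0 + x1].
Proof.
elim/stensor_ind: x => [|x y [x0 [x1 [h0 h1 ->]]] [y0 [y1 [g0 g1 ->]]]|i j u v hu hv].
- by exists 0, 0; rewrite addr0; split=> //; exact: sh_0.
- by exists (x0 + y0), (x1 + y1); rewrite addrACA; split=> //; exact: sh_add.
have h := sh_tens hu hv; case: (i (+) j) h => h.
- by exists 0, (u ⊗ v); rewrite add0r; split=> //; exact: sh_0.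
- by exists (u ⊗ v), 0; rewrite addr0; split=> //; exact: sh_0.
Qed.

Let tpart (k : bool) (u : A) (v : B) : T :=
  \sum_(i : bool) tens (hpart i u) (hpart (i (+) k) v).

Let tpart_bilinear k : bilinear_for *:%R *:%R (tpart k).
Proof.
split=> [v l x y|u l x y] /=; rewrite /tpart scaler_sumr -big_split;
  apply: eq_bigr => i _ /=; rewrite linearP.
  by rewrite tensDl tensZl.
by rewrite tensDr tensZr.
Qed.

Let tpart_homog l k (z : T) : stensor_homog k z ->
  tensor_lift (tpart l) z = if k == l then z else 0.
Proof.
have l_lin := tensor_lift_linear (tpart_bilinear l).
have l0 : tensor_lift (tpart l) 0 = 0.
  by have := l_lin (-1) 0 0; rewrite scaler0 addr0 scaleN1r addNr.
have lD x y : tensor_lift (tpart l) (x + y) =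
    tensor_lift (tpart l) x + tensor_lift (tpart l) y.
  by have := l_lin 1 x y; rewrite !scale1r.
elim=> {k z}.
- by move=> k; rewrite l0 if_same.
- by move=> k x y _ IHx _ IHy; rewrite lD IHx IHy; case: eqP; rewrite ?addr0.
move=> i j u v hu hv; rewrite tensor_lift_tens // /tpart big_bool.
have t0l (w : B) : tens (0 : A) w = 0 by rewrite -(scale0r 0) tensZl scale0r.
have t0r (w : A) : tens w (0 : B) = 0 by rewrite -(scale0r 0) tensZr scale0r.
rewrite /= !(hpart_homog _ hu, hpart_homog _ hv).
by case: i j l {hu hv l_lin l0 lD} => [] [] []; rewrite /= ?(t0l, t0r, addr0, add0r).
Qed.

Lemma stensor_homog_direct (x : T) :
  stensor_homog false x -> stensor_homog true x -> x = 0.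
Proof. by move=> /(tpart_homog false) e0 /(tpart_homog false); rewrite e0. Qed.

HB.instance Definition _ := isSuperAlgebra.Build K T
  sh_0 stensor_homogP stensor_homogM stensor_homog_decomp stensor_homog_direct.

End SuperTensor.

Definition even_map (K : fieldType) (A B : superAlgType K) (f : A -> B) : Prop :=
  forall i u, homog i u -> homog i (f u).

(* The ground field sits in degree 0. *)
Section GroundField.
Variable K : fieldType.

Definition ground_homog (i : bool) : set K^o := fun k => i -> k = 0.

Lemma ground_homog0 i : ground_homog i 0.
Proof. by []. Qed.

Lemma ground_homogP i k (u v : K^o) :
  ground_homog i u -> ground_homog i v -> ground_homog i (k *: u + v).
Proof. by move=> hu hv hi; rewrite hu // hv // scaler0 addr0. Qed.

Lemma ground_homogM i j (u v : K^o) :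
  ground_homog i u -> ground_homog j v -> ground_homog (i (+) j) (u * v).
Proof.
case: i j => [] [] // hu hv _; first by rewrite hu // mul0r.
by rewrite hv // mulr0.
Qed.

Lemma ground_homog_decomp (u : K^o) :
  exists u0 u1, [/\ ground_homog false u0, ground_homog true u1 & u = u0 + u1].
Proof. by exists u, 0; rewrite addr0. Qed.

Lemma ground_homog_direct (u : K^o) :
  ground_homog false u -> ground_homog true u -> u = 0.
Proof. by move=> _ ->. Qed.

HB.instance Definition _ := isSuperAlgebra.Build K K^o
  ground_homog0 ground_homogP ground_homogM ground_homog_decomp
  ground_homog_direct.

End GroundField.

(* tensor_assoc, tensor_unitl and tensor_unitr are the identifications
   (U (x) V) (x) W = U (x) (V (x) W), K (x) V = V and V (x) K = V that are
   tacit in the usual formulas. *)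
Record superBialg (K : fieldType) := SuperBialg {
  sba_alg :> superAlgType K;
  comul : {lrmorphism sba_alg -> sba_alg ⊗ sba_alg};
  counit : {lrmorphism sba_alg -> K^o};
  comul_even : even_map comul;
  counit_even : even_map counit;
  comul_coassoc : forall u : sba_alg,
    tensor_assoc (tensor_map comul idfun (comul u)) =
    tensor_map idfun comul (comul u);
  counit_l : forall u : sba_alg,
    tensor_unitl (tensor_map counit idfun (comul u)) = u;
  counit_r : forall u : sba_alg,
    tensor_unitr (tensor_map idfun counit (comul u)) = u
}.

Record left_quantum_space (K : fieldType) (A : superBialg K)
    (B : superAlgType K) (psi : {lrmorphism B -> A ⊗ B}) : Prop := {
  lqs_even : even_map psi;
  lqs_coassoc : forall u : B,
    tensor_map idfun psi (psi u) =
    tensor_assoc (tensor_map (comul A) idfun (psi u));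
  lqs_counit : forall u : B,
    tensor_unitl (tensor_map (counit A) idfun (psi u)) = u
}.

Record right_quantum_space (K : fieldType) (A : superBialg K)
    (B : superAlgType K) (psi : {lrmorphism B -> B ⊗ A}) : Prop := {
  rqs_even : even_map psi;
  rqs_coassoc : forall u : B,
    tensor_assoc (tensor_map psi idfun (psi u)) =
    tensor_map idfun (comul A) (psi u);
  rqs_counit : forall u : B,
    tensor_unitr (tensor_map idfun (counit A) (psi u)) = u
}.

Definition generated_by (K : fieldType) (A : algType K) (S : seq A) : Prop :=
  forall P : {pred A},
    GRing.subalg_closed P -> {subset S <= P} -> forall u, u \in P.

(* K<x, y> / (x y = t y x) as expressions modulo the congruence generated by
   the K-algebra axioms and that relation; no relation is imposed on y ^ 2. *)
Inductive qexpr (K : Type) : Type :=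
| QConst of K
| QX
| QY
| QAdd of qexpr K & qexpr K
| QMul of qexpr K & qexpr K.

Arguments QX {K}.
Arguments QY {K}.

HB.instance Definition _ (K : Type) := gen_eqMixin (qexpr K).
HB.instance Definition _ (K : Type) := gen_choiceMixin (qexpr K).

Section QuantumSuperplane.
Variables (K : fieldType) (t : K).

Inductive qcong : qexpr K -> qexpr K -> Prop :=
| qc_refl u : qcong u u
| qc_sym u v : qcong u v -> qcong v u
| qc_trans u v w : qcong u v -> qcong v w -> qcong u w
| qc_add u u' v v' : qcong u u' -> qcong v v' -> qcong (QAdd u v) (QAdd u' v')
| qc_mul u u' v v' : qcong u u' -> qcong v v' -> qcong (QMul u v) (QMul u' v')
| qc_addA u v w : qcong (QAdd u (QAdd v w)) (QAdd (QAdd u v) w)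
| qc_addC u v : qcong (QAdd u v) (QAdd v u)
| qc_add0 u : qcong (QAdd (QConst 0) u) u
| qc_addN u : qcong (QAdd (QMul (QConst (-1)) u) u) (QConst 0)
| qc_mulA u v w : qcong (QMul u (QMul v w)) (QMul (QMul u v) w)
| qc_mul1 u : qcong (QMul (QConst 1) u) u
| qc_mulDl u v w : qcong (QMul (QAdd u v) w) (QAdd (QMul u w) (QMul v w))
| qc_mulDr u v w : qcong (QMul u (QAdd v w)) (QAdd (QMul u v) (QMul u w))
| qc_constD k l : qcong (QConst (k + l)) (QAdd (QConst k) (QConst l))
| qc_constM k l : qcong (QConst (k * l)) (QMul (QConst k) (QConst l))
| qc_constC k u : qcong (QMul (QConst k) u) (QMul u (QConst k))
| qc_rel : qcong (QMul QX QY) (QMul (QConst t) (QMul QY QX)).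

Definition qcongb (u v : qexpr K) : bool := `[< qcong u v >].

Lemma qcongb_refl : reflexive qcongb.
Proof. by move=> u; apply/asboolP; exact: qc_refl. Qed.

Lemma qcongb_sym : symmetric qcongb.
Proof. by move=> u v; apply/asboolP/asboolP => /qc_sym. Qed.

Lemma qcongb_trans : transitive qcongb.
Proof.
move=> v u w /asboolP uv /asboolP vw; apply/asboolP; exact: qc_trans uv vw.
Qed.

Canonical qcong_equiv := EquivRel qcongb qcongb_refl qcongb_sym qcongb_trans.

Definition qsuperplane := {eq_quot qcong_equiv}.

HB.instance Definition _ : EqQuotient _ qcong_equiv qsuperplane :=
  EqQuotient.on qsuperplane.
HB.instance Definition _ := Choice.on qsuperplane.

Definition qof (e : qexpr K) : qsuperplane := \pi_qsuperplane e.

Lemma qofP (P : qsuperplane -> Prop) : (forall e, P (qof e)) -> forall u, P u.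
Proof. by move=> h u; rewrite -[u]reprK; exact: h. Qed.

Lemma qof_eqP e1 e2 : qcong e1 e2 <-> qof e1 = qof e2.
Proof. by split=> [e12|/eqmodP/asboolP//]; apply/eqmodP/asboolP. Qed.

Lemma qcong_repr e : qcong (repr (qof e)) e.
Proof. by apply/qof_eqP; rewrite /qof reprK. Qed.

Definition qadd (u v : qsuperplane) : qsuperplane := qof (QAdd (repr u) (repr v)).
Definition qmul (u v : qsuperplane) : qsuperplane := qof (QMul (repr u) (repr v)).

Lemma qadd_of e1 e2 : qadd (qof e1) (qof e2) = qof (QAdd e1 e2).
Proof. by apply/qof_eqP; apply: qc_add; exact: qcong_repr. Qed.

Lemma qmul_of e1 e2 : qmul (qof e1) (qof e2) = qof (QMul e1 e2).
Proof. by apply/qof_eqP; apply: qc_mul; exact: qcong_repr. Qed.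

Lemma qaddA : associative qadd.
Proof.
elim/qofP => a; elim/qofP => b; elim/qofP => c; rewrite !qadd_of.
by apply/qof_eqP; exact: qc_addA.
Qed.

Lemma qaddC : commutative qadd.
Proof.
by elim/qofP => a; elim/qofP => b; rewrite !qadd_of; apply/qof_eqP; exact: qc_addC.
Qed.

Lemma qadd0 : left_id (qof (QConst 0)) qadd.
Proof. by elim/qofP => a; rewrite qadd_of; apply/qof_eqP; exact: qc_add0. Qed.

Lemma qaddN : left_inverse (qof (QConst 0)) (qmul (qof (QConst (-1)))) qadd.
Proof.
by elim/qofP => a; rewrite qmul_of qadd_of; apply/qof_eqP; exact: qc_addN.
Qed.

HB.instance Definition _ :=
  GRing.isZmodule.Build qsuperplane qaddA qaddC qadd0 qaddN.

Lemma qmulA : associative qmul.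
Proof.
elim/qofP => a; elim/qofP => b; elim/qofP => c; rewrite !qmul_of.
by apply/qof_eqP; exact: qc_mulA.
Qed.

Lemma qmulC_const k u : qmul (qof (QConst k)) u = qmul u (qof (QConst k)).
Proof.
by elim/qofP: u => a; rewrite !qmul_of; apply/qof_eqP; exact: qc_constC.
Qed.

Lemma qmul1l : left_id (qof (QConst 1)) qmul.
Proof. by elim/qofP => a; rewrite qmul_of; apply/qof_eqP; exact: qc_mul1. Qed.

Lemma qmul1r : right_id (qof (QConst 1)) qmul.
Proof. by move=> u; rewrite -qmulC_const qmul1l. Qed.

Lemma qmulDl : left_distributive qmul +%R.
Proof.
elim/qofP => a; elim/qofP => b; elim/qofP => c.
rewrite [_ + _]qadd_of !qmul_of [RHS]qadd_of.
by apply/qof_eqP; exact: qc_mulDl.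
Qed.

Lemma qmulDr : right_distributive qmul +%R.
Proof.
elim/qofP => a; elim/qofP => b; elim/qofP => c.
rewrite [_ + _]qadd_of !qmul_of [RHS]qadd_of.
by apply/qof_eqP; exact: qc_mulDr.
Qed.

(* Evaluation at x = y = 0 shows that the presented algebra is nonzero. *)
Fixpoint qaug (e : qexpr K) : K :=
  match e with
  | QConst k => k
  | QX | QY => 0
  | QAdd e1 e2 => qaug e1 + qaug e2
  | QMul e1 e2 => qaug e1 * qaug e2
  end.

Lemma qaug_cong e1 e2 : qcong e1 e2 -> qaug e1 = qaug e2.
Proof.
elim=> {e1 e2} //=.
- by move=> u v w _ -> _ ->.
- by move=> u u' v v' _ -> _ ->.
- by move=> u u' v v' _ -> _ ->.
- by move=> u v w; rewrite addrA.
- by move=> u v; rewrite addrC.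
- by move=> u; rewrite add0r.
- by move=> u; rewrite mulN1r addNr.
- by move=> u v w; rewrite mulrA.
- by move=> u; rewrite mul1r.
- by move=> u v w; rewrite mulrDl.
- by move=> u v w; rewrite mulrDr.
- by move=> k u; rewrite mulrC.
- by rewrite !mulr0.
Qed.

Lemma qone_neq0 : qof (QConst 1) != 0.
Proof.
by apply/eqP => /qof_eqP/qaug_cong /= /eqP; rewrite oner_eq0.
Qed.

HB.instance Definition _ := GRing.Zmodule_isNzRing.Build qsuperplane
  qmulA qmul1l qmul1r qmulDl qmulDr qone_neq0.

Definition qscale (k : K) (u : qsuperplane) : qsuperplane := qof (QConst k) * u.

Lemma qscaleA k l u : qscale k (qscale l u) = qscale (k * l) u.
Proof.
rewrite /qscale mulrA; congr (_ * _); rewrite [LHS]qmul_of.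
by apply/esym/qof_eqP; exact: qc_constM.
Qed.

Lemma qscale1 : left_id 1 qscale.
Proof. by move=> u; exact: mul1r. Qed.

Lemma qscaleDr : right_distributive qscale +%R.
Proof. by move=> k u v; exact: mulrDr. Qed.

Lemma qscaleDl u : {morph qscale^~ u : k l / k + l}.
Proof.
move=> k l; rewrite /qscale -mulrDl; congr (_ * _); rewrite [RHS]qadd_of.
by apply/qof_eqP; exact: qc_constD.
Qed.

HB.instance Definition _ := GRing.Zmodule_isLmodule.Build K qsuperplane
  qscaleA qscale1 qscaleDr qscaleDl.

Lemma qscaleAl k (u v : qsuperplane) : k *: (u * v) = (k *: u) * v.
Proof. exact: mulrA. Qed.

HB.instance Definition _ :=
  GRing.Lmodule_isLalgebra.Build K qsuperplane qscaleAl.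

Lemma qscaleAr k (u v : qsuperplane) : k *: (u * v) = u * (k *: v).
Proof.
rewrite -[LHS]/(qof (QConst k) * (u * v)) -[k *: v]/(qof (QConst k) * v).
by rewrite !mulrA; congr (_ * _); exact: qmulC_const.
Qed.

HB.instance Definition _ :=
  GRing.Lalgebra_isAlgebra.Build K qsuperplane qscaleAr.

Definition qx : qsuperplane := qof QX.
Definition qy : qsuperplane := qof QY.

Lemma qconstE k : qof (QConst k) = k%:A.
Proof. by rewrite -[LHS]mulr1. Qed.

Lemma qxy : qx * qy = t *: (qy * qx).
Proof.
rewrite [LHS]qmul_of [qy * qx]qmul_of [RHS]qmul_of.
by apply/qof_eqP; exact: qc_rel.
Qed.

Lemma qsuperplane_ind (P : qsuperplane -> Prop) :
  (forall k, P k%:A) -> P qx -> P qy ->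
  (forall u v, P u -> P v -> P (u + v)) ->
  (forall u v, P u -> P v -> P (u * v)) -> forall u, P u.
Proof.
move=> Pc Px Py PD PM; elim/qofP; elim=> [k|||a Pa b Pb|a Pa b Pb] //.
- by rewrite qconstE.
- by rewrite -qadd_of; exact: PD.
- by rewrite -qmul_of; exact: PM.
Qed.

Inductive qhomog : bool -> set qsuperplane :=
| qh_const k : qhomog false k%:A
| qh_x : qhomog false qx
| qh_y : qhomog true qy
| qh_0 i : qhomog i 0
| qh_add i u v : qhomog i u -> qhomog i v -> qhomog i (u + v)
| qh_mul i j u v : qhomog i u -> qhomog j v -> qhomog (i (+) j) (u * v).

Lemma qhomogP i k u v : qhomog i u -> qhomog i v -> qhomog i (k *: u + v).
Proof.
move=> hu; apply: qh_add; rewrite -mulr_algl.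
exact: qh_mul (qh_const k) hu.
Qed.

Lemma qhomog_decomp u :
  exists u0 u1, [/\ qhomog false u0, qhomog true u1 & u = u0 + u1].
Proof.
elim/qsuperplane_ind: u.
- by move=> k; exists k%:A, 0; rewrite addr0; split=> //; [exact: qh_const|exact: qh_0].
- by exists qx, 0; rewrite addr0; split=> //; [exact: qh_x|exact: qh_0].
- by exists 0, qy; rewrite add0r; split=> //; [exact: qh_0|exact: qh_y].
- move=> u v [u0 [u1 [hu0 hu1 ->]]] [v0 [v1 [hv0 hv1 ->]]].
  by exists (u0 + v0), (u1 + v1); rewrite addrACA; split=> //; exact: qh_add.
move=> u v [u0 [u1 [hu0 hu1 ->]]] [v0 [v1 [hv0 hv1 ->]]].
exists (u0 * v0 + u1 * v1), (u0 * v1 + u1 * v0); split.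
- by apply: qh_add; [exact: qh_mul hu0 hv0|exact: qh_mul hu1 hv1].
- by apply: qh_add; [exact: qh_mul hu0 hv1|exact: qh_mul hu1 hv0].
by rewrite mulrDl !mulrDr [u1 * v0 + _]addrC addrACA.
Qed.

Fixpoint qpart (e : qexpr K) (i : bool) : qsuperplane :=
  match e with
  | QConst k => if i then 0 else k%:A
  | QX => if i then 0 else qx
  | QY => if i then qy else 0
  | QAdd e1 e2 => qpart e1 i + qpart e2 i
  | QMul e1 e2 => qpart e1 false * qpart e2 i + qpart e1 true * qpart e2 (~~ i)
  end.

Lemma qpart_cong e1 e2 : qcong e1 e2 -> qpart e1 =1 qpart e2.
Proof.
elim=> {e1 e2} //=.
- by move=> u v _ h i; rewrite h.
- by move=> u v w _ h1 _ h2 i; rewrite h1 h2.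
- by move=> u u' v v' _ h1 _ h2 i; rewrite h1 h2.
- by move=> u u' v v' _ h1 _ h2 i; rewrite !h1 !h2.
- by move=> u v w i; rewrite addrA.
- by move=> u v i; rewrite addrC.
- by move=> u i; rewrite scale0r if_same add0r.
- by move=> u i; rewrite mul0r addr0 mulr_algl scaleN1r addNr scale0r if_same.
- move=> u v w i; rewrite !(mulrDl, mulrDr) !mulrA !negbK -!addrA; congr (_ + _).
  by rewrite [RHS]addrC -addrA; congr (_ + _); rewrite addrC.
- by move=> u i; rewrite mul0r addr0 scale1r mul1r.
- by move=> u v w i; rewrite !mulrDl addrACA.
- by move=> u v w i; rewrite !mulrDr addrACA.
- by move=> k l [] /=; rewrite ?addr0 // scalerDl.
- by move=> k l [] /=; rewrite !(mul0r, mulr0, addr0) // mulr_algl scalerA.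
- by move=> k u [] /=; rewrite !(mul0r, mulr0, addr0, add0r) mulr_algl mulr_algr.
- case=> /=; rewrite !(mul0r, mulr0, addr0, add0r) //.
  by rewrite qxy mulr_algl.
Qed.

Lemma qpart_homog j i u : qhomog i u -> qpart (repr u) j = if i == j then u else 0.
Proof.
have part_of e k : qpart (repr (qof e)) k = qpart e k.
  exact/qpart_cong/qcong_repr.
have partD (u1 u2 : qsuperplane) k :
    qpart (repr (u1 + u2)) k = qpart (repr u1) k + qpart (repr u2) k.
  exact: (part_of (QAdd (repr u1) (repr u2))).
have partM (u1 u2 : qsuperplane) k : qpart (repr (u1 * u2)) k =
    qpart (repr u1) false * qpart (repr u2) k +
    qpart (repr u1) true * qpart (repr u2) (~~ k).
  exact: (part_of (QMul (repr u1) (repr u2))).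
move=> hu; elim: hu j => {i u}.
- by move=> k j; rewrite -qconstE part_of /= qconstE; case: j.
- by case; rewrite part_of.
- by case; rewrite part_of.
- by move=> i j; rewrite [LHS]part_of /= scale0r !if_same.
- by move=> i u v _ hu _ hv j; rewrite partD hu hv; case: eqP; rewrite ?addr0.
- move=> i i' u v _ hu _ hv j; rewrite partM !hu !hv.
  by case: i i' j {hu hv} => [] [] []; rewrite /= !(mul0r, mulr0, addr0, add0r).
Qed.

Lemma qhomog_direct u : qhomog false u -> qhomog true u -> u = 0.
Proof. by move=> /(qpart_homog false) e0 /(qpart_homog false); rewrite e0. Qed.

HB.instance Definition _ := isSuperAlgebra.Build K qsuperplane
  qh_0 qhomogP qh_mul qhomog_decomp qhomog_direct.

Lemma homog_qx : homog false qx.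
Proof. exact: qh_x. Qed.

Lemma homog_qy : homog true qy.
Proof. exact: qh_y. Qed.

End QuantumSuperplane.

(* Main.v *)
(* Since x y = t y x is the only relation of O, an assignment on x and y extends
   to O exactly when the images X, Y satisfy X Y = t Y X.  Expanding this and
   comparing coefficients of x^2, y x, y^2 gives, for psi_L, three relations
   including a d - d a = t^-1 b c + t c b, and, for psi_R, three relations
   including a d - d a = - (t^-1 c b + t b c).  Together they force
   (1 + t^2) (b c + c b) = 0, where 1 + t^2 = 1 - q is nonzero.  Coassociativity
   and the counit identity compare two algebra morphisms, hence need checking
   only at x and y, where the linear independence of x and y turns them into the
   formulas for Delta and epsilon. *)
Require Import Defs.
From HB Require Import structures.
From mathcomp Require Import all_boot all_order all_algebra.
From mathcomp Require Import boolp classical_sets reals complex.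

Set Implicit Arguments.
Unset Strict Implicit.
Unset Printing Implicit Defensive.

Import Order.TTheory GRing.Theory Num.Theory.
Local Open Scope ring_scope.

(** * Algebra morphisms as a predicate on plain functions *)

Section AlgebraMorphisms.
Variables (K : fieldType).

(** Kept unbundled so that composites of [tensor_map], [tensor_assoc] and the unit maps can be
    compared without giving each one a bundled morphism structure. *)
Definition algebra_morphism (A B : algType K) (f : A -> B) : Prop :=
  [/\ linear f, f 1 = 1 & {morph f : u v / u * v}].

Lemma algebra_morphism_lrmorphism (A B : algType K) (f : {lrmorphism A -> B}) :
  algebra_morphism f.
Proof. by split; [exact: linearP|exact: rmorph1|exact: rmorphM]. Qed.

Lemma algebra_morphism_comp (A B C : algType K) (f : B -> C) (g : A -> B) :
  algebra_morphism f -> algebra_morphism g -> algebra_morphism (f \o g).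
Proof.
move=> [fL f1 fM] [gL g1 gM].
by split=> [k u v||u v] /=; rewrite ?(gL, g1, gM) ?(fL, f1, fM).
Qed.

Lemma linear_map0 (U V : lmodType K) (f : U -> V) : linear f -> f 0 = 0.
Proof. by move=> fL; have := fL (-1) 0 0; rewrite scaler0 addr0 scaleN1r addNr. Qed.

Lemma linear_mapD (U V : lmodType K) (f : U -> V) :
  linear f -> {morph f : u v / u + v}.
Proof. by move=> fL u v; have := fL 1 u v; rewrite !scale1r. Qed.

Lemma linear_mapZ (U V : lmodType K) (f : U -> V) k :
  linear f -> {morph f : u / k *: u}.
Proof. by move=> fL u; have := fL k u 0; rewrite (linear_map0 fL) !addr0. Qed.

End AlgebraMorphisms.

(** * Linearity of the canonical tensor maps, and contraction with a functional *)

Section Tensors.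
Variables (K : fieldType).

Lemma tens0l (U V : lmodType K) (v : V) : tens (0 : U) v = 0.
Proof. by rewrite -(scale0r 0) tensZl scale0r. Qed.

Lemma tensor_map_linear (U V U' V' : lmodType K)
    (f : {linear U -> U'}) (g : {linear V -> V'}) : linear (tensor_map f g).
Proof. exact/tensor_lift_linear/tensor_map_bilinear. Qed.

Lemma tensor_assoc_linear (U V W : lmodType K) : linear (@tensor_assoc K U V W).
Proof.
apply: tensor_lift_linear; split=> [w|x k w w'] /=.
  exact/tensor_lift_linear/tensor_assoc_bilinear.
by apply: tensor_lift_fun_linear => u v; rewrite !(tensDr, tensZr).
Qed.

Lemma tensor_unitl_linear (V : lmodType K) : linear (@tensor_unitl K V).
Proof.
apply: tensor_lift_linear; split=> [v l a b|a l v v'] /=.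
  by rewrite scalerDl scalerA.
by rewrite scalerDr !scalerA mulrC.
Qed.

Lemma tensor_unitr_linear (V : lmodType K) : linear (@tensor_unitr K V).
Proof.
apply: tensor_lift_linear; split=> [a l v v'|v l a b] /=.
  by rewrite scalerDr !scalerA mulrC.
by rewrite scalerDl scalerA.
Qed.

Section Contraction.
Variables (U V : lmodType K).

(** The slice map [id ⊗ f]. With [f] chosen to pick out one monomial, it extracts a coefficient and
    so replaces arguments by linear independence. *)
Definition contractr (f : {linear V -> K^o}) (z : tensor U V) : U :=
  tensor_unitr (tensor_map idfun f z).

Definition contractl (f : {linear U -> K^o}) (z : tensor U V) : V :=
  tensor_unitl (tensor_map f idfun z).

Lemma contractr_linear f : linear (contractr f).
Proof.
by move=> k z z'; rewrite /contractr tensor_map_linear tensor_unitr_linear.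
Qed.

Lemma contractl_linear f : linear (contractl f).
Proof.
by move=> k z z'; rewrite /contractl tensor_map_linear tensor_unitl_linear.
Qed.

HB.instance Definition _ f :=
  GRing.isLinear.Build K (tensor U V) U *:%R (contractr f) (contractr_linear f).

HB.instance Definition _ f :=
  GRing.isLinear.Build K (tensor U V) V *:%R (contractl f) (contractl_linear f).

Lemma contractr_tens f u v : contractr f (tens u v) = (f v : K) *: u.
Proof. by rewrite /contractr tensor_map_tens tensor_unitr_tens. Qed.

Lemma contractl_tens f u v : contractl f (tens u v) = (f u : K) *: v.
Proof. by rewrite /contractl tensor_map_tens tensor_unitl_tens. Qed.

End Contraction.

(** Slicing the last of three factors does not see the bracketing. This isolates the value of the
    comultiplication in the coassociativity identity. *)
Lemma contractr_assoc (U V W : lmodType K) (f : {linear W -> K^o})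
    (z : tensor U V) (w : W) :
  tensor_map idfun (contractr f) (tensor_assoc (tens z w)) = (f w : K) *: z.
Proof.
elim/tensor_ind: z => [|z z' IHz IHz'|u v].
- rewrite tens0l (linear_map0 (@tensor_assoc_linear _ _ _)).
  by rewrite (linear_map0 (@tensor_map_linear _ _ _ _ _ _)) scaler0.
- rewrite tensDl (linear_mapD (@tensor_assoc_linear _ _ _)).
  by rewrite (linear_mapD (@tensor_map_linear _ _ _ _ _ _)) IHz IHz' scalerDr.
by rewrite tensor_assoc_tens tensor_map_tens /= contractr_tens tensZr.
Qed.

End Tensors.

(** * Multiplicativity of the canonical maps under the sign rule *)

Section SuperTensors.
Variables (K : fieldType).

Lemma even_idfun (A : superAlgType K) : even_map (@idfun A).
Proof. by []. Qed.

(** The sign depends only on the parities of the two inner factors, and even maps preserve these. *)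
Lemma tensor_map_algebra_morphism (A B A' B' : superAlgType K)
    (f : {lrmorphism A -> A'}) (g : {lrmorphism B -> B'}) :
  even_map f -> even_map g ->
  algebra_morphism (tensor_map f g : A ⊗ B -> A' ⊗ B').
Proof.
move=> f_even g_even.
have L : linear (tensor_map f g : A ⊗ B -> A' ⊗ B') by exact: tensor_map_linear.
split=> //; first by rewrite [LHS]tensor_map_tens !rmorph1.
move=> x y; elim/stensor_ind: x => [|x x' IHx IHx'|i j u v hu hv].
- by rewrite mul0r (linear_map0 L) mul0r.
- by rewrite mulrDl !(linear_mapD L) mulrDl IHx IHx'.
elim/stensor_ind: y => [|y y' IHy IHy'|i' j' u' v' hu' hv'].
- by rewrite mulr0 (linear_map0 L) mulr0.
- by rewrite mulrDr !(linear_mapD L) mulrDr IHy IHy'.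
rewrite (stens_mul _ _ hv hu') (linear_mapZ _ L) !tensor_map_tens !rmorphM.
by rewrite (stens_mul _ _ (g_even _ _ hv) (f_even _ _ hu')).
Qed.

(** Reduces to pure tensors homogeneous in every factor, where all signs are explicit. *)
Lemma stensor3_ind (A B C : superAlgType K) (P : (A ⊗ B)%type ⊗ C -> Prop) :
  P 0 -> (forall x y, P x -> P y -> P (x + y)) ->
  (forall i j k u v w, homog i u -> homog j v -> homog k w ->
    P (tens (tens u v : A ⊗ B) w)) -> forall x, P x.
Proof.
move=> P0 PD Pt; apply: stensor_ind => // _ k z w _ hw.
elim/stensor_ind: z => [|z z' IHz IHz'|i j u v hu hv].
- by rewrite tens0l.
- by rewrite tensDl; exact: PD.
- exact: Pt hu hv hw.
Qed.

(** With parities [j], [k] of [v], [w] and [i'], [j'] of [u'], [v'], the two bracketings give the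
    sign exponents k(i' + j') + j i' and (j + k) i' + k j', which agree. *)
Lemma tensor_assoc_algebra_morphism (A B C : superAlgType K) :
  algebra_morphism (@tensor_assoc K A B C : (A ⊗ B)%type ⊗ C -> A ⊗ (B ⊗ C)%type).
Proof.
have L : linear (@tensor_assoc K A B C : (A ⊗ B)%type ⊗ C -> A ⊗ (B ⊗ C)%type).
  exact: tensor_assoc_linear.
split=> //; first by rewrite [LHS]tensor_assoc_tens.
move=> x y; elim/stensor3_ind: x => [|x x' IHx IHx'|i j k u v w hu hv hw].
- by rewrite mul0r (linear_map0 L) mul0r.
- by rewrite mulrDl !(linear_mapD L) mulrDl IHx IHx'.
elim/stensor3_ind: y => [|y y' IHy IHy'|i' j' k' u' v' w' hu' hv' hw'].
- by rewrite mulr0 (linear_map0 L) mulr0.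
- by rewrite mulrDr !(linear_mapD L) mulrDr IHy IHy'.
rewrite !tensor_assoc_tens.
rewrite (stens_mul _ _ hw (sh_tens hu' hv')) (stens_mul _ _ hv hu').
rewrite (stens_mul _ _ (sh_tens hv hw) hu') (stens_mul _ _ hw hv').
rewrite (linear_mapZ _ L) tensZl tensZr (linear_mapZ _ L) tensor_assoc_tens.
rewrite !scalerA -!signr_addb; congr (_ ^+ nat_of_bool _ *: _).
by case: j {hv} k {hw} i' {hu'} j' {hv'} => [] [] [] [].
Qed.

Lemma ground_even (k : K^o) : homog false k.
Proof. by []. Qed.

Lemma tensor_unitl_algebra_morphism (A : superAlgType K) :
  algebra_morphism (@tensor_unitl K A : K^o ⊗ A -> A).
Proof.
have L : linear (@tensor_unitl K A : K^o ⊗ A -> A) by exact: tensor_unitl_linear.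
split=> //; first by rewrite [LHS]tensor_unitl_tens scale1r.
move=> x y; elim/stensor_ind: x => [|x x' IHx IHx'|i j u v hu hv].
- by rewrite mul0r (linear_map0 L) mul0r.
- by rewrite mulrDl !(linear_mapD L) mulrDl IHx IHx'.
elim/stensor_ind: y => [|y y' IHy IHy'|i' j' u' v' hu' hv'].
- by rewrite mulr0 (linear_map0 L) mulr0.
- by rewrite mulrDr !(linear_mapD L) mulrDr IHy IHy'.
rewrite (stens_mul _ _ hv (ground_even u')) andbF scale1r !tensor_unitl_tens.
by rewrite -scalerAl -scalerAr scalerA.
Qed.

Lemma tensor_unitr_algebra_morphism (A : superAlgType K) :
  algebra_morphism (@tensor_unitr K A : A ⊗ K^o -> A).
Proof.
have L : linear (@tensor_unitr K A : A ⊗ K^o -> A) by exact: tensor_unitr_linear.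
split=> //; first by rewrite [LHS]tensor_unitr_tens scale1r.
move=> x y; elim/stensor_ind: x => [|x x' IHx IHx'|i j u v hu hv].
- by rewrite mul0r (linear_map0 L) mul0r.
- by rewrite mulrDl !(linear_mapD L) mulrDl IHx IHx'.
elim/stensor_ind: y => [|y y' IHy IHy'|i' j' u' v' hu' hv'].
- by rewrite mulr0 (linear_map0 L) mulr0.
- by rewrite mulrDr !(linear_mapD L) mulrDr IHy IHy'.
rewrite (stens_mul _ _ (ground_even v) hu') scale1r !tensor_unitr_tens.
by rewrite -scalerAl -scalerAr scalerA.
Qed.

End SuperTensors.

(** * Universal property of the quantum superplane, and functionals on it *)

Section Superplane.
Variables (K : fieldType) (t : K).
Local Notation O := (qsuperplane t).
Local Notation x := (qx t).
Local Notation y := (qy t).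

Section Lift.
Variables (A : algType K) (u v : A).

Fixpoint qeval (e : qexpr K) : A :=
  match e with
  | QConst k => k%:A
  | QX => u
  | QY => v
  | QAdd e1 e2 => qeval e1 + qeval e2
  | QMul e1 e2 => qeval e1 * qeval e2
  end.

Hypothesis uv : u * v = t *: (v * u).

Lemma qeval_cong e1 e2 : qcong t e1 e2 -> qeval e1 = qeval e2.
Proof.
elim=> {e1 e2} //=.
- by move=> e1 e2 e3 _ -> _ ->.
- by move=> e1 e1' e2 e2' _ -> _ ->.
- by move=> e1 e1' e2 e2' _ -> _ ->.
- by move=> *; rewrite addrA.
- by move=> *; rewrite addrC.
- by move=> *; rewrite scale0r add0r.
- by move=> *; rewrite scaleN1r mulN1r addNr scale0r.
- by move=> *; rewrite mulrA.
- by move=> *; rewrite scale1r mul1r.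
- by move=> *; rewrite mulrDl.
- by move=> *; rewrite mulrDr.
- by move=> *; rewrite scalerDl.
- by move=> *; rewrite mulr_algl scalerA.
- by move=> *; rewrite mulr_algl mulr_algr.
- by rewrite mulr_algl.
Qed.

(** Evaluation of expressions respects the defining congruence as soon as [u] and [v] satisfy the
    relation, so it descends to the quotient. *)
Lemma qsuperplane_lift : exists f : {lrmorphism O -> A}, f x = u /\ f y = v.
Proof.
pose f (z : O) := qeval (repr z).
(* Independence of the representative. Sums and products in the quotient are classes of [QAdd] and
   [QMul] expressions, so additivity and multiplicativity are instances of this. *)
have fE e : f (qof t e) = qeval e by exact/qeval_cong/qcong_repr.
have fD z z' : f (z + z') = f z + f z' by exact: (fE (QAdd (repr z) (repr z'))).
have fM z z' : f (z * z') = f z * f z' by exact: (fE (QMul (repr z) (repr z'))).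
have f_lin : linear f.
  by move=> k z z'; rewrite fD -mulr_algl fM -qconstE fE /= mulr_algl.
have f_mon : monoid_morphism f.
  by split=> //; rewrite [LHS](fE (QConst 1)) /= scale1r.
pose F := HB.pack_for {lrmorphism O -> A} f
  (GRing.isLinear.Build K O A *:%R f f_lin)
  (GRing.isMonoidMorphism.Build O A f f_mon).
by exists F; split; exact: fE.
Qed.

End Lift.

Lemma qsuperplane_ext (A : algType K) (f g : O -> A) :
  algebra_morphism f -> algebra_morphism g -> f x = g x -> f y = g y -> f =1 g.
Proof.
move=> [fL f1 fM] [gL g1 gM] fgx fgy; elim/qsuperplane_ind => //.
- by move=> k; rewrite (linear_mapZ k fL) (linear_mapZ k gL) f1 g1.
- by move=> u v fu fv; rewrite (linear_mapD fL) (linear_mapD gL) fu fv.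
- by move=> u v fu fv; rewrite fM gM fu fv.
Qed.

Lemma qsuperplane_even (A : superAlgType K) (f : {lrmorphism O -> A}) :
  homog false (f x) -> homog true (f y) -> even_map f.
Proof.
move=> fx fy i u; elim=> {i u} //.
- by move=> k; rewrite linearZ rmorph1; exact/homogZ/homog1.
- by move=> i; rewrite linear0; exact: homog0.
- by move=> i u v _ fu _ fv; rewrite linearD; exact: homogD.
- by move=> i j u v _ fu _ fv; rewrite rmorphM; exact: homogM.
Qed.

(** Being multiplicative, this character also sends x^2 to 1 and both y x and y^2 to 0; [eval_y]
    does the same for y^2. No character isolates y x in this way, which is why [functional_yx] is
    merely linear. *)
Lemma eval_x : exists f : {lrmorphism O -> K^o}, f x = 1 /\ f y = 0.
Proof. by apply: qsuperplane_lift; rewrite mulr0 mul0r scaler0. Qed.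

Lemma eval_y : exists f : {lrmorphism O -> K^o}, f x = 0 /\ f y = 1.
Proof. by apply: qsuperplane_lift; rewrite mulr0 mul0r scaler0. Qed.

(* The upper right entry under x |-> diag(t, 1), y |-> E_12. *)
Lemma functional_yx : exists f : {linear O -> K^o},
  [/\ f (x * x) = 0, f (y * x) = 1 & f (y * y) = 0].
Proof.
pose X : 'M[K]_2 := \matrix_(i, j) (if i == j then if i == 0 then t else 1 else 0).
pose Y : 'M[K]_2 := \matrix_(i, j) ((i == 0) && (j == 1))%:R.
have [|F [Fx Fy]] := @qsuperplane_lift 'M[K]_2 X Y.
  (* Here X Y = t E_12 and Y X = E_12; moreover X^2 is diagonal and Y^2 = 0, which gives the three
     values. *)
  apply/matrixP => i j; rewrite !mxE !big_ord_recl !big_ord0 !mxE.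
  by case: i => [[|[|//]] ?]; case: j => [[|[|//]] ?];
    rewrite /= !(mulr0, mul0r, mulr1, mul1r, addr0, add0r).
pose f (z : O) : K^o := F z 0 1.
have f_lin : linear f by move=> k z z'; rewrite /f linearP !mxE.
have fM u v : f (u * v) = (F u *m F v) 0 1 by rewrite /f rmorphM.
exists (HB.pack_for {linear O -> K^o} f
  (GRing.isLinear.Build K O K^o *:%R f f_lin)).
by split; rewrite /= fM ?(Fx, Fy) !mxE !big_ord_recl !big_ord0 !mxE /=
  !(mulr0, mul0r, mulr1, mul1r, addr0, add0r).
Qed.

End Superplane.

(** The right-hand form is what comparing coefficients of y x in X Y = t Y X produces; dividing by
    [t] gives the commutator form. *)
Lemma scaled_relation (K : fieldType) (V : lmodType K) (t : K) (p q r s : V) :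
  t != 0 ->
  p - q = t^-1 *: r + t *: s <-> t *: p - r = t *: (t *: s + q).
Proof.
move=> t0; split=> /eqP; rewrite subr_eq => /eqP e.
  by rewrite e -addrA scalerDr scalerA divff // scale1r addrAC subrr add0r.
apply: (scalerI t0); rewrite scalerBr e !scalerDr.
rewrite [_ *: (t^-1 *: _)]scalerA divff // scale1r.
by rewrite addrAC addrK addrC.
Qed.

(** * Relations among [a], [b], [c], [d] forced by each coaction *)

Section Coactions.
Variables (K : fieldType) (t : K) (t_neq0 : t != 0).
Local Notation O := (qsuperplane t).
Local Notation x := (qx t).
Local Notation y := (qy t).
Variables (B : superAlgType K) (a b c d : B).
Hypotheses (a_even : homog false a) (b_odd : homog true b).
Hypotheses (c_odd : homog true c) (d_even : homog false d).

Lemma left_coaction_relations :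
  let X : B ⊗ O := a ⊗ x + b ⊗ y in let Y : B ⊗ O := c ⊗ x + d ⊗ y in
  X * Y = t *: (Y * X) <->
  [/\ a * c = t *: (c * a), b * d = - (t *: (d * b)) &
      a * d - d * a = t^-1 *: (b * c) + t *: (c * b)].
Proof.
move=> X Y.
(* One product rule for each pair of inner factors; a minus sign appears exactly when [y] passes [b]
   or [c]. *)
have mulE := (fun u v => stens_mul u v (homog_qx t) a_even,
  fun u v => stens_mul u v (homog_qx t) b_odd,
  fun u v => stens_mul u v (homog_qx t) c_odd,
  fun u v => stens_mul u v (homog_qx t) d_even,
  fun u v => stens_mul u v (homog_qy t) a_even,
  fun u v => stens_mul u v (homog_qy t) b_odd,
  fun u v => stens_mul u v (homog_qy t) c_odd,
  fun u v => stens_mul u v (homog_qy t) d_even).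
have XY : X * Y = (a * c) ⊗ (x * x) + (t *: (a * d) - b * c) ⊗ (y * x) +
    (b * d) ⊗ (y * y).
  rewrite mulrDl !mulrDr !mulE /= expr0 expr1 !scale1r qxy.
  by rewrite tensDl tensZl tensZr -[- (b * c)]scaleN1r tensZl !addrA.
have YX : Y * X = (c * a) ⊗ (x * x) + (t *: (c * b) + d * a) ⊗ (y * x) +
    (- (d * b)) ⊗ (y * y).
  rewrite mulrDl !mulrDr !mulE /= expr0 expr1 !scale1r qxy.
  by rewrite tensDl tensZl tensZr -[- (d * b)]scaleN1r tensZl !addrA.
have midE := scaled_relation (a * d) (d * a) (b * c) (c * b) t_neq0.
rewrite XY YX; split=> [e|[-> -> /midE ->]]; last first.
  by rewrite -scalerN !tensZl !scalerDr.
(* The three functionals are dual to x^2, y^2 and y x; contracting with each yields one relation. *)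
have [fx [fxx fxy]] := eval_x t.
have [fy [fyx fyy]] := eval_y t.
have [f [fx2 fyx2 fy2]] := functional_yx t.
have E (g : {linear O -> K^o}) := congr1 (contractr g) e.
split.
- have := E fx; rewrite linearZ /= !linearD /= !contractr_tens !rmorphM /=.
  by rewrite fxx fxy !(mulr0, mulr1, mul0r, scale0r, scaler0, addr0, scale1r).
- have := E fy; rewrite linearZ /= !linearD /= !contractr_tens !rmorphM /=.
  by rewrite fyx fyy !(mulr0, mulr1, mul0r, scale0r, scaler0, addr0, add0r,
    scale1r)
    scalerN.
- apply/midE; have := E f; rewrite linearZ /= !linearD /= !contractr_tens.
  by rewrite fx2 fyx2 fy2 !(scalerDr, scale0r, scaler0, addr0, add0r, scale1r).
Qed.

Lemma right_coaction_relations :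
  let X : O ⊗ B := x ⊗ a + y ⊗ c in let Y : O ⊗ B := x ⊗ b + y ⊗ d in
  X * Y = t *: (Y * X) <->
  [/\ a * b = t *: (b * a), c * d = - (t *: (d * c)) &
      a * d - d * a = - (t^-1 *: (c * b) + t *: (b * c))].
Proof.
move=> X Y.
have mulE := (fun u v => stens_mul u v a_even (homog_qx t),
  fun u v => stens_mul u v b_odd (homog_qx t),
  fun u v => stens_mul u v c_odd (homog_qx t),
  fun u v => stens_mul u v d_even (homog_qx t),
  fun u v => stens_mul u v a_even (homog_qy t),
  fun u v => stens_mul u v b_odd (homog_qy t),
  fun u v => stens_mul u v c_odd (homog_qy t),
  fun u v => stens_mul u v d_even (homog_qy t)).
have XY : X * Y = (x * x) ⊗ (a * b) + (y * x) ⊗ (t *: (a * d) + c * b) +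
    (y * y) ⊗ (- (c * d)).
  rewrite mulrDl !mulrDr !mulE /= expr0 expr1 !scale1r qxy.
  by rewrite tensDr tensZl tensZr -[- (c * d)]scaleN1r tensZr !addrA.
have YX : Y * X = (x * x) ⊗ (b * a) + (y * x) ⊗ (- (t *: (b * c)) + d * a) +
    (y * y) ⊗ (d * c).
  rewrite mulrDl !mulrDr !mulE /= expr0 expr1 !scale1r qxy.
  by rewrite tensDr tensZl -[- (t *: _)]scaleN1r !tensZr !addrA.
(* Compared with the left coaction, [b] and [c] trade places and both products change sign. *)
have := scaled_relation (a * d) (d * a) (- (c * b)) (- (b * c)) t_neq0.
rewrite !scalerN opprK -opprD => midE.
rewrite XY YX; split=> [e|[-> -> /midE ->]]; last first.
  by rewrite opprK !tensZr !scalerDr.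
have [fx [fxx fxy]] := eval_x t.
have [fy [fyx fyy]] := eval_y t.
have [f [fx2 fyx2 fy2]] := functional_yx t.
have E (g : {linear O -> K^o}) := congr1 (contractl g) e.
split.
- have := E fx; rewrite linearZ /= !linearD /= !contractl_tens !rmorphM /=.
  by rewrite fxx fxy !(mulr0, mulr1, mul0r, scale0r, scaler0, addr0, scale1r).
- have := E fy; rewrite linearZ /= !linearD /= !contractl_tens !rmorphM /=.
  rewrite fyx fyy !(mulr0, mulr1, mul0r, scale0r, scaler0, addr0, add0r,
    scale1r).
  by move=> <-; rewrite opprK.
- apply/midE; have := E f; rewrite linearZ /= !linearD /= !contractl_tens.
  by rewrite fx2 fyx2 fy2 !(scalerDr, scale0r, scaler0, addr0, add0r, scale1r).
Qed.

End Coactions.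

(** * Quantum space axioms versus the coalgebra formulas *)

Section QuantumSpaces.
Variables (K : fieldType) (t : K).
Local Notation O := (qsuperplane t).
Local Notation x := (qx t).
Local Notation y := (qy t).
Variables (B : superBialg K) (a b c d : B).

(** The matrix M with rows (a, b) and (c, d) is multiplicative: Delta(M) = M ⊗ M under matrix
    multiplication, and epsilon(M) is the identity matrix. *)
Definition matrix_bialgebra_structure : Prop :=
  [/\ comul B a = a ⊗ a + b ⊗ c, comul B b = a ⊗ b + b ⊗ d,
      comul B c = c ⊗ a + d ⊗ c & comul B d = c ⊗ b + d ⊗ d] /\
  [/\ counit B a = 1, counit B d = 1, counit B b = 0 & counit B c = 0].

Lemma scale_xy_inj (k l k' l' : K) :
  k *: x + l *: y = k' *: x + l' *: y -> k = k' /\ l = l'.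
Proof.
have [fx [fxx fxy]] := eval_x t; have [fy [fyx fyy]] := eval_y t.
move=> e; have := congr1 fx e; have := congr1 fy e.
rewrite !linearD !linearZ /= fxx fxy fyx fyy !(scaler0, addr0, add0r).
by rewrite ![_ *: 1]mulr1.
Qed.

Lemma left_quantum_space_structure (psi : {lrmorphism O -> B ⊗ O}) :
  psi x = a ⊗ x + b ⊗ y -> psi y = c ⊗ x + d ⊗ y ->
  left_quantum_space psi -> matrix_bialgebra_structure.
Proof.
move=> px py [_ psi_coassoc psi_counit].
(* Stated for an arbitrary row (u, v), so that it serves for both (a, b) and (c, d). Slicing the
   last factor at [x] gives Delta(u), at [y] Delta(v). *)
have coassocE u v (z := (u ⊗ x + v ⊗ y : B ⊗ O)) :
    tensor_map idfun psi z = tensor_assoc (tensor_map (comul B) idfun z) ->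
    comul B u = u ⊗ a + v ⊗ c /\ comul B v = u ⊗ b + v ⊗ d.
  rewrite /z !(linear_mapD (@tensor_map_linear _ _ _ _ _ _ _))
    !tensor_map_tens /= px py => e.
  have [fx [fxx fxy]] := eval_x t; have [fy [fyx fyy]] := eval_y t.
  have E (f : {linear O -> K^o}) := congr1 (tensor_map idfun (contractr f)) e.
  have mapD f := linear_mapD
    (@tensor_map_linear K B (tensor B O) B B idfun (contractr f)).
  split; [have := E fx | have := E fy];
    rewrite (linear_mapD (@tensor_assoc_linear _ _ _ _)) !mapD !tensor_map_tens
      !contractr_assoc;
    rewrite !linearD /= !contractr_tens /= ?(fxx, fxy, fyx, fyy);
    by rewrite !(scale0r, scale1r, addr0, add0r).
have counitE u v (z := (u ⊗ x + v ⊗ y : B ⊗ O)) :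
    tensor_unitl (tensor_map (counit B) idfun z) =
    (counit B u : K) *: x + (counit B v : K) *: y.
  rewrite /z (linear_mapD (@tensor_map_linear _ _ _ _ _ _ _)) !tensor_map_tens /=.
  by rewrite (linear_mapD (@tensor_unitl_linear _ _)) !tensor_unitl_tens.
have := psi_coassoc x; rewrite {1 2}px => /coassocE[Da Db].
have := psi_coassoc y; rewrite {1 2}py => /coassocE[Dc Dd].
split=> //.
have := psi_counit x; have := psi_counit y; rewrite px py !counitE => ey ex.
have [] := @scale_xy_inj (counit B a) (counit B b) 1 0.
  by rewrite ex scale1r scale0r addr0.
have [] := @scale_xy_inj (counit B c) (counit B d) 0 1.
  by rewrite ey scale1r scale0r add0r.
by move=> -> -> -> ->.
Qed.

Hypotheses (a_even : homog false a) (b_odd : homog true b).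
Hypotheses (c_odd : homog true c) (d_even : homog false d).
Hypothesis B_struct : matrix_bialgebra_structure.

Lemma structure_left_quantum_space (psi : {lrmorphism O -> B ⊗ O}) :
  psi x = a ⊗ x + b ⊗ y -> psi y = c ⊗ x + d ⊗ y -> left_quantum_space psi.
Proof.
have [[Da Db Dc Dd] [ea ed eb ec]] := B_struct; move=> px py.
(* Established first, since multiplicativity of [id ⊗ psi] rests on it. *)
have psi_even : even_map psi.
  apply: qsuperplane_even; rewrite (px, py); apply: homogD.
  - exact: sh_tens a_even (homog_qx t).
  - exact: sh_tens b_odd (homog_qy t).
  - exact: sh_tens c_odd (homog_qx t).
  - exact: sh_tens d_even (homog_qy t).
have psiM := algebra_morphism_lrmorphism psi.
have id_psiM :=
  tensor_map_algebra_morphism (f := idfun) (@even_idfun K B) psi_even.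
have comul_idM :=
  tensor_map_algebra_morphism (g := idfun) (@comul_even K B) (@even_idfun K O).
have counit_idM :=
  tensor_map_algebra_morphism (g := idfun) (@counit_even K B) (@even_idfun K O).
have assocM := @tensor_assoc_algebra_morphism K B B O.
have assocD := linear_mapD (@tensor_assoc_linear K B B O).
have id_psiD := linear_mapD
  (@tensor_map_linear K B O B (B ⊗ O)%type idfun psi).
have comul_idD := linear_mapD
  (@tensor_map_linear K B O (B ⊗ B)%type O (comul B) idfun).
have counit_idD := linear_mapD (@tensor_map_linear K B O K^o O (counit B) idfun).
split=> //.
- apply: (qsuperplane_ext (algebra_morphism_comp id_psiM psiM)
    (algebra_morphism_comp assocM (algebra_morphism_comp comul_idM psiM))) => /=.
  + rewrite px id_psiD comul_idD !tensor_map_tens /= px py Da Db.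
    (* One side groups the four terms by the first factor, the other by the last; [addrACA] swaps
       the middle two. *)
    by rewrite assocD !tensDl !assocD !tensor_assoc_tens !tensDr addrACA.
  + rewrite py id_psiD comul_idD !tensor_map_tens /= px py Dc Dd.
    by rewrite assocD !tensDl !assocD !tensor_assoc_tens !tensDr addrACA.
- apply: (qsuperplane_ext (algebra_morphism_comp (@tensor_unitl_algebra_morphism K O)
    (algebra_morphism_comp counit_idM psiM))
    (algebra_morphism_lrmorphism idfun)) => /=.
  + rewrite px counit_idD (linear_mapD (@tensor_unitl_linear K O)).
    by rewrite !tensor_map_tens !tensor_unitl_tens /= ea eb scale1r scale0r addr0.
  + rewrite py counit_idD (linear_mapD (@tensor_unitl_linear K O)).
    by rewrite !tensor_map_tens !tensor_unitl_tens /= ec ed scale1r scale0r add0r.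
Qed.

Lemma structure_right_quantum_space (psi : {lrmorphism O -> O ⊗ B}) :
  psi x = x ⊗ a + y ⊗ c -> psi y = x ⊗ b + y ⊗ d -> right_quantum_space psi.
Proof.
have [[Da Db Dc Dd] [ea ed eb ec]] := B_struct; move=> px py.
have psi_even : even_map psi.
  apply: qsuperplane_even; rewrite (px, py); apply: homogD.
  - exact: sh_tens (homog_qx t) a_even.
  - exact: sh_tens (homog_qy t) c_odd.
  - exact: sh_tens (homog_qx t) b_odd.
  - exact: sh_tens (homog_qy t) d_even.
have psiM := algebra_morphism_lrmorphism psi.
have psi_idM :=
  tensor_map_algebra_morphism (g := idfun) psi_even (@even_idfun K B).
have id_comulM :=
  tensor_map_algebra_morphism (f := idfun) (@even_idfun K O) (@comul_even K B).
have id_counitM :=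
  tensor_map_algebra_morphism (f := idfun) (@even_idfun K O) (@counit_even K B).
have assocM := @tensor_assoc_algebra_morphism K O B B.
have assocD := linear_mapD (@tensor_assoc_linear K O B B).
have psi_idD := linear_mapD
  (@tensor_map_linear K O B (O ⊗ B)%type B psi idfun).
have id_comulD := linear_mapD
  (@tensor_map_linear K O B O (B ⊗ B)%type idfun (comul B)).
have id_counitD := linear_mapD (@tensor_map_linear K O B O K^o idfun (counit B)).
split=> //.
- apply: (qsuperplane_ext
    (algebra_morphism_comp assocM (algebra_morphism_comp psi_idM psiM))
    (algebra_morphism_comp id_comulM psiM)) => /=.
  + rewrite px psi_idD id_comulD !tensor_map_tens /= px py Da Dc.
    by rewrite assocD !tensDl !assocD !tensor_assoc_tens !tensDr addrACA.
  + rewrite py psi_idD id_comulD !tensor_map_tens /= px py Db Dd.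
    by rewrite assocD !tensDl !assocD !tensor_assoc_tens !tensDr addrACA.
- apply: (qsuperplane_ext (algebra_morphism_comp (@tensor_unitr_algebra_morphism K O)
    (algebra_morphism_comp id_counitM psiM))
    (algebra_morphism_lrmorphism idfun)) => /=.
  + rewrite px id_counitD (linear_mapD (@tensor_unitr_linear K O)).
    by rewrite !tensor_map_tens !tensor_unitr_tens /= ea ec scale1r scale0r addr0.
  + rewrite py id_counitD (linear_mapD (@tensor_unitr_linear K O)).
    by rewrite !tensor_map_tens !tensor_unitr_tens /= eb ed scale1r scale0r add0r.
Qed.

End QuantumSpaces.

(** * Equivalence of the two coactions with the relations and the coalgebra formulas *)

Theorem theorem2p1 (R : realType) (q s t : R[i])
    (q_neq0 : q != 0)
    (q_not_root : forall n : nat, (0 < n)%N -> q ^+ n != 1)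
    (s_sqrt : s ^+ 2 = q) (t_def : t = 'i * s)
    (B : superBialg R[i]) (a b c d : B)
    (gen : generated_by [:: a; b; c; d])
    (a_even : homog false a) (b_odd : homog true b)
    (c_odd : homog true c) (d_even : homog false d) :
  ((exists psiL : {lrmorphism qsuperplane t -> B ⊗ qsuperplane t},
      [/\ psiL (qx t) = a ⊗ qx t + b ⊗ qy t,
          psiL (qy t) = c ⊗ qx t + d ⊗ qy t
        & left_quantum_space psiL]) /\
   (exists psiR : {lrmorphism qsuperplane t -> qsuperplane t ⊗ B},
      [/\ psiR (qx t) = qx t ⊗ a + qy t ⊗ c,
          psiR (qy t) = qx t ⊗ b + qy t ⊗ d
        & right_quantum_space psiR]))
  <->
  [/\ [/\ a * b = t *: (b * a), a * c = t *: (c * a) & b * c = - (c * b)],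
      [/\ b * d = - (t *: (d * b)), c * d = - (t *: (d * c))
        & a * d - d * a = (t^-1 - t) *: (b * c)],
      [/\ comul B a = a ⊗ a + b ⊗ c, comul B b = a ⊗ b + b ⊗ d,
          comul B c = c ⊗ a + d ⊗ c & comul B d = c ⊗ b + d ⊗ d]
    & [/\ counit B a = 1, counit B d = 1, counit B b = 0 & counit B c = 0]].
Proof.
have t2 : t ^+ 2 = - q by rewrite t_def exprMn sqrCi s_sqrt mulN1r.
have t0 : t != 0 by rewrite -sqrf_eq0 t2 oppr_eq0.
have t21 : 1 + t ^+ 2 != 0.
  (* The hypothesis on roots of 1, taken at exponent 1. *)
  by rewrite t2 subr_eq0 eq_sym -[q]expr1 q_not_root.
have Lrel := left_coaction_relations t0 a_even b_odd c_odd d_even.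
have Rrel := right_coaction_relations t0 a_even b_odd c_odd d_even.
split=> [[[L [Lx Ly L_space]] [P [Px Py _]]]|].
  have : L (qx t) * L (qy t) = t *: (L (qy t) * L (qx t)).
    by rewrite -!rmorphM -linearZ qxy.
  rewrite Lx Ly => /Lrel[ac bd adL].
  have : P (qx t) * P (qy t) = t *: (P (qy t) * P (qx t)).
    by rewrite -!rmorphM -linearZ qxy.
  rewrite Px Py => /Rrel[ab cd adR].
  (* Equating the two expressions for a d - d a and multiplying by [t] gives (1 + t^2)(b c + c b) =
     0. *)
  have bc : b * c = - (c * b).
    apply/eqP; rewrite -addr_eq0; apply/eqP/(scalerI t21).
    have /eqP := etrans (esym adL) adR; rewrite -addr_eq0 => /eqP e.
    have := congr1 ( *:%R t) e; rewrite !scaler0 !scalerDr !scalerA.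
    rewrite divff // !scale1r => <-.
    rewrite !scalerDl !scale1r expr2.
    by rewrite addrACA [_ + t * t *: _ in LHS]addrC addrACA.
  have [D E] := left_quantum_space_structure Lx Ly L_space.
  split=> //; split=> //.
  by rewrite adL -[c * b]opprK -bc scalerN scalerBl.
case=> [[ab ac bc] [bd cd ad] D E].
(* With this, the mixed relations of both coactions collapse to a d - d a = (t^-1 - t) b c. *)
have cb : c * b = - (b * c) by rewrite bc opprK.
have St : matrix_bialgebra_structure a b c d by [].
split.
  have [|psi [px py]] := @qsuperplane_lift _ t (B ⊗ qsuperplane t)%type
      (a ⊗ qx t + b ⊗ qy t) (c ⊗ qx t + d ⊗ qy t).
    by apply/Lrel; split=> //; rewrite ad cb scalerN scalerBl.
  exists psi; split=> //; exact: structure_left_quantum_space px py.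
have [|psi [px py]] := @qsuperplane_lift _ t (qsuperplane t ⊗ B)%type
    (qx t ⊗ a + qy t ⊗ c) (qx t ⊗ b + qy t ⊗ d).
  by apply/Rrel; split=> //; rewrite ad cb scalerN opprD opprK scalerBl.
exists psi; split=> //; exact: structure_right_quantum_space px py.
Qed.
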